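(* Let $\Omega=(a,b)$ be a finite open interval, $0<\alpha<1$ and $1\le p<\infty$. Then there exists a constant $C=C(\alpha,\Omega)>0$ such that $$\|u-c_{\pm}^{1-\alpha}\kappa_{\pm}^{\alpha}\|_{L^p(\Omega)}\le C\|{}^{\pm}\mathcal{D}^{\alpha}u\|_{L^p(\Omega)}\qquad\forall u\in{}^{\pm}W^{\alpha,p}(\Omega).$$ (This holds for each of the signs $-$ and $+$.)
   Context: For $0<\alpha<1$ and $\varphi\in C_0^\infty(\mathbb{R})$: ${}^{-}D^{\alpha}\varphi(x)=\frac{1}{\Gamma(1-\alpha)}\frac{d}{dx}\int_{-\infty}^x\frac{\varphi(y)}{(x-y)^{\alpha}}dy$ and ${}^{+}D^{\alpha}\varphi(x)=\frac{-1}{\Gamma(1-\alpha)}\frac{d}{dx}\int_x^{\infty}\frac{\varphi(y)}{(y-x)^{\alpha}}dy$. For $u\in L^1(\Omega)$, $v\in L^1_{loc}(\Omega)$ is the left (resp. right) weak fractional derivative of $u$, $v={}^{-}\mathcal{D}^{\alpha}u$ (resp. ${}^{+}\mathcal{D}^{\alpha}u$), if $\int_\Omega v\varphi\,dx=\int_\Omega u\,{}^{+}D^{\alpha}\tilde\varphi\,dx$ (resp. with ${}^{-}D^{\alpha}\tilde\varphi$) for all $\varphi\in C_0^\infty(\Omega)$, where $\tilde\varphi$ is the zero extension of $\varphi$ to $\mathbb{R}$. ${}^{\pm}W^{\alpha,p}(\Omega)=\{u\in L^p(\Omega): {}^{\pm}\mathcal{D}^{\alpha}u\in L^p(\Omega)\}$.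 Kernel functions: $\kappa_-^{\alpha}(x)=(x-a)^{\alpha-1}$, $\kappa_+^{\alpha}(x)=(b-x)^{\alpha-1}$. Fractional integrals ($\sigma>0$): ${}^{-}I^{\sigma}f(x)=\frac{1}{\Gamma(\sigma)}\int_a^x\frac{f(y)}{(x-y)^{1-\sigma}}dy$, ${}^{+}I^{\sigma}f(x)=\frac{1}{\Gamma(\sigma)}\int_x^b\frac{f(y)}{(y-x)^{1-\sigma}}dy$. For $u\in{}^{\pm}W^{\alpha,p}(\Omega)$ the function ${}^{\pm}I^{1-\alpha}u$ has a representative continuous on $[a,b]$, and $c_-^{1-\alpha}=\frac{{}^{-}I^{1-\alpha}u(a)}{\Gamma(\alpha)}$, $c_+^{1-\alpha}=\frac{{}^{+}I^{1-\alpha}u(b)}{\Gamma(\alpha)}$ (values of these representatives); these are the constants for which $u=c_{\pm}^{1-\alpha}\kappa_{\pm}^{\alpha}+{}^{\pm}I^{\alpha}\,{}^{\pm}\mathcal{D}^{\alpha}u$ a.e. in $\Omega$. *)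

(* Defs.v *)
From HB Require Import structures.
From mathcomp Require Import all_boot all_order all_algebra.
From mathcomp Require Import all_classical all_reals all_analysis.
Import Order.TTheory GRing.Theory Num.Theory.
Import numFieldNormedType.Exports.

Set Implicit Arguments.
Unset Strict Implicit.
Unset Printing Implicit Defensive.

Local Open Scope classical_set_scope.
Local Open Scope ring_scope.

(* Functions on Omega = ]a, b[ are represented by total functions R -> R; every
   definition below only uses their values on Omega, except for test functions,
   which are identified with their zero extension to R. *)

Section FractionalCalculus.
Context {R : realType}.
Implicit Types (a b alpha sigma p z x : R) (D : set R) (f u v phi : R -> R).

Local Notation mu := (@lebesgue_measure R).

Definition Gamma z : R :=
  \int[mu]_(t in `]0, +oo[) (t `^ (z - 1) * expR (- t)).

Definition Lp_norm D p f : \bar R := 'N[mu]_(p%:E)[EFin \o (f \_ D)].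

Definition in_Lp D p f : Prop := (f \_ D) \in Lfun mu p%:E.

Definition test_function D phi : Prop :=
  [/\ forall n x, derivable (derive1n n phi) x 1,
      compact (closure [set x | phi x != 0]) &
      closure [set x | phi x != 0] `<=` D].

Definition left_fderiv alpha phi x : R :=
  (Gamma (1 - alpha))^-1 *
  derive1 (fun t : R => \int[mu]_(y in `]-oo, t[) (phi y / (t - y) `^ alpha)) x.

Definition right_fderiv alpha phi x : R :=
  - (Gamma (1 - alpha))^-1 *
  derive1 (fun t : R => \int[mu]_(y in `]t, +oo[) (phi y / (y - t) `^ alpha)) x.

Definition is_left_weak_fderiv a b alpha u v : Prop :=
  [/\ mu.-integrable `]a, b[ (EFin \o u),
      locally_integrable `]a, b[ v &
      forall phi, test_function `]a, b[ phi ->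
        \int[mu]_(x in `]a, b[) (v x * phi x) =
        \int[mu]_(x in `]a, b[) (u x * right_fderiv alpha phi x)].

Definition is_right_weak_fderiv a b alpha u v : Prop :=
  [/\ mu.-integrable `]a, b[ (EFin \o u),
      locally_integrable `]a, b[ v &
      forall phi, test_function `]a, b[ phi ->
        \int[mu]_(x in `]a, b[) (v x * phi x) =
        \int[mu]_(x in `]a, b[) (u x * left_fderiv alpha phi x)].

Definition left_fSobolev a b alpha p : set (R -> R) :=
  [set u | in_Lp `]a, b[ p u /\
           exists v, is_left_weak_fderiv a b alpha u v /\ in_Lp `]a, b[ p v].

Definition right_fSobolev a b alpha p : set (R -> R) :=
  [set u | in_Lp `]a, b[ p u /\
           exists v, is_right_weak_fderiv a b alpha u v /\ in_Lp `]a, b[ p v].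

Definition left_fint a sigma f x : R :=
  (Gamma sigma)^-1 * \int[mu]_(y in `]a, x[) (f y / (x - y) `^ (1 - sigma)).

Definition right_fint b sigma f x : R :=
  (Gamma sigma)^-1 * \int[mu]_(y in `]x, b[) (f y / (y - x) `^ (1 - sigma)).

(* The value at t of the representative of f that is continuous on [a, b].
   It does not depend on the representative when t \in `[a, b] and a < b;
   it is 0 by convention when there is no such representative. *)
Definition cont_rep_value a b f (t : R) : R :=
  xget 0 [set l | exists g : R -> R,
    [/\ {within `[a, b], continuous g}, f = g %[ae mu in `]a, b[%classic] & g t = l]].

Definition left_kernel a alpha x : R := (x - a) `^ (alpha - 1).

Definition right_kernel b alpha x : R := (b - x) `^ (alpha - 1).

Definition left_const a b alpha u : R :=
  cont_rep_value a b (left_fint a (1 - alpha) u) a / Gamma alpha.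

Definition right_const a b alpha u : R :=
  cont_rep_value a b (right_fint b (1 - alpha) u) b / Gamma alpha.

End FractionalCalculus.

(* Main.v *)
(* Let w = ^-I^(1-alpha) u.  Testing the weak derivative against phi and moving
   phi' onto the fractional integral by Fubini shows that w' = v weakly, so by
   the du Bois-Reymond lemma w = K + \int_a^x v almost everywhere, and K is the
   value at a of the continuous representative of w.  Applying ^-I^alpha to both
   expressions of w, the beta integral B(alpha, 1 - alpha) =
   Gamma(alpha) Gamma(1 - alpha) gives \int_a^x u = \int_a^x (c kappa + I^alpha v)
   for every x, hence u - c kappa = I^alpha v almost everywhere.  On a bounded
   interval I^alpha is the convolution with the integrable kernel
   t^(alpha-1) / Gamma(alpha) truncated to ]0, b - a[, so Young's inequality bounds
   it on L^p by the L^1 norm of that kernel, uniformly in p.  The right-sided case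
   follows by the reflection x |-> - x. *)

Require Import Defs.
From HB Require Import structures.
From mathcomp Require Import all_boot all_order all_algebra.
From mathcomp Require Import all_classical all_reals all_analysis.
From mathcomp Require Import measurable_realfun ring lra.
Import Order.TTheory GRing.Theory Num.Theory.
Import numFieldNormedType.Exports.

Set Implicit Arguments.
Unset Strict Implicit.
Unset Printing Implicit Defensive.

Local Open Scope classical_set_scope.
Local Open Scope ring_scope.

(** * Affine changes of variables in the Lebesgue integral *)

Section affine_change_of_variables.
Context {R : realType}.
Local Notation mu := (@lebesgue_measure R).
Local Open Scope ereal_scope.
Implicit Types (c d : R) (f : R -> \bar R).

(** An integral here is a real number even when it diverges, so an exchange of integrals needs
    genuine integrability. For this reason u and v are replaced by zero extensions and fractional
    integrals by convolutions on the whole line with truncated, integrable kernels; every exchange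
    in the representation formula is then an instance of [convolution_fubini]. Since u is merely
    integrable, the integral of order alpha of w cannot be differentiated pointwise. It is evaluated
    at one fixed x at a time, which compares primitives of integrable functions; Lebesgue
    differentiation turns their equality into an almost everywhere equality. [Gamma] would be 0 if
    its integral diverged. That it is finite and positive at alpha and 1 - alpha is read off from
    the product formula, computed in the extended reals, and from the bounds 1 <= B(alpha, 1 -
    alpha) < +oo. The final constant is (b - a)^alpha / Gamma(alpha + 1), plus 1 to keep it visibly
    positive. *)

Lemma measurable_affine c d :
  measurable_fun [set: R] (fun x : R => (c + d * x)%R).
Proof. by apply: measurable_funD => //; apply: measurable_funM. Qed.

(** By uniqueness of Lebesgue measure: the pushforward multiplied by [|d|] gives each []x, y]] its
    length. The sign of [d] decides which end of the preimage is closed, hence the two cases. *)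
Lemma lebesgue_measure_affine c d (d0 : d != 0%R) (A : set R) : measurable A ->
  pushforward mu ((fun x : R => (c + d * x)%R) : _ -> measurableTypeR R) A =
  (`|d|^-1)%:E * mu A.
Proof.
move=> mA.
have -> : mu A = mscale (NngNum (normr_ge0 d))
   (pushforward mu ((fun x : R => (c + d * x)%R) : _ -> measurableTypeR R)) A; last first.
  by rewrite /mscale/= muleA -EFinM mulVf ?mul1e// normr_eq0.
  exact: measurable_affine.
move=> mf; apply: lebesgue_measure_unique => //= _ [[x y] /= xy <-].
rewrite /mscale/= /pushforward/= lebesgue_measure_itv/= lte_fin.
have [dpos|dneg] := ltP 0%R d.
  have -> : (fun z : R => c + d * z)%R @^-1` `]x, y] = `](x - c) / d, (y - c) / d]%classic%R.
    by apply/seteqP; split => z /=;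
      rewrite !in_itv/= ltr_pdivrMr // ler_pdivlMr // ltrBlDl lerBrDl (mulrC z).
  rewrite lebesgue_measure_itv/= lte_fin ltr_pM2r ?invr_gt0// ltrD2r.
  case: ifPn => [xyl|_]; last by rewrite mule0.
  rewrite -!EFinB -EFinM gtr0_norm//; congr EFin.
  by rewrite -mulrBl mulrCA mulfV // mulr1 opprB addrA subrK.
have {}dneg : (d < 0)%R by rewrite lt_neqAle d0.
have -> : (fun z : R => c + d * z)%R @^-1` `]x, y] = `[(y - c) / d, (x - c) / d[%classic%R.
  by apply/seteqP; split => z /=;
    rewrite !in_itv/= ltr_ndivlMr // ler_ndivrMr // ltrBlDl lerBrDl (mulrC z) andbC.
rewrite lebesgue_measure_itv/= lte_fin ltr_nM2r ?invr_lt0// ltrD2r.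
case: ifPn => [xyl|_]; last by rewrite mule0.
rewrite -!EFinB -EFinM ltr0_norm//; congr EFin.
by rewrite -mulrBl mulrCA mulNr mulfV // mulrN1 !opprB addrA subrK.
Qed.

Lemma ge0_integral_affine c d (d0 : d != 0%R) f : measurable_fun [set: R] f ->
  (forall x, 0 <= f x) ->
  \int[mu]_x f (c + d * x)%R = (`|d|^-1)%:E * \int[mu]_x f x.
Proof.
move=> mf f0.
have h0 : (0 <= `|d|^-1)%R by rewrite invr_ge0.
have mphi := measurable_affine c d.
rewrite -(@ge0_integral_mscale _ _ _ mu setT measurableT (NngNum h0) _ mf)//.
rewrite -(@ge0_integral_pushforward _ _ (measurableTypeR R) (measurableTypeR R) _ _ mphi mu setT f)//.
apply: eq_measure_integral => /= A mA _.
exact: lebesgue_measure_affine.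
Qed.

Lemma integral_affine c d (d0 : d != 0%R) f : measurable_fun [set: R] f ->
  \int[mu]_x f (c + d * x)%R = (`|d|^-1)%:E * \int[mu]_x f x.
Proof.
move=> mf; rewrite integralE [in RHS]integralE.
have hp := ge0_integral_affine c d0 (measurable_funepos mf) (fun x => funepos_ge0 _ x).
have hn := ge0_integral_affine c d0 (measurable_funeneg mf) (fun x => funeneg_ge0 _ x).
rewrite -[X in X - _]/(\int[mu]_x (f \o (fun x : R => (c + d * x)%R))^\+ x).
rewrite -[X in _ - X]/(\int[mu]_x (f \o (fun x : R => (c + d * x)%R))^\- x).
rewrite funepos_comp funeneg_comp /= hp hn.
have : (0 < `|d|^-1)%R by rewrite invr_gt0 normr_gt0.
(* Without integrability both parts may be infinite; a positive real factor distributes over the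
   difference in every case, +oo - +oo included. *)
move: (`|d|^-1)%R (\int[mu]_x f^\+ x) (\int[mu]_x f^\- x) => r [x||] [y||] r0 //;
  rewrite ?(gt0_muley, gt0_muleNy, gt0_mulye) //= -?EFinB -?EFinM -?EFinB ?mulrBr//.
Qed.

End affine_change_of_variables.

(** * Convolution on the line: Fubini exchange and Young's inequality *)

Section convolution.
Context {R : realType}.
Local Notation mu := (@lebesgue_measure R).
Implicit Types (f k q P : R -> R).

(** Where the integrand is not integrable the value is 0 by default, so linear identities can be
    expected only almost everywhere. *)
Definition convolution f k (x : R) : R := \int[mu]_y (f y * k (x - y)).

Lemma measurable_translate q c : measurable_fun [set: R] q ->
  measurable_fun [set: R] (fun t => q (t - c)).
Proof.
move=> mq; apply: (measurableT_comp mq); exact: measurable_funB.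
Qed.

Lemma measurable_reflect q c : measurable_fun [set: R] q ->
  measurable_fun [set: R] (fun t => q (c - t)).
Proof.
move=> mq; apply: (measurableT_comp mq); exact: measurable_funB.
Qed.

Lemma integral_translate (g : R -> \bar R) (c : R) : measurable_fun [set: R] g ->
  (\int[mu]_x g (x - c)%R = \int[mu]_x g x)%E.
Proof.
move=> mg; have := integral_affine (- c) (oner_neq0 R) mg.
rewrite normr1 invr1 mul1e => <-.
by apply: eq_integral => x _; rewrite mul1r addrC.
Qed.

Lemma integral_reflect (g : R -> \bar R) (c : R) : measurable_fun [set: R] g ->
  (\int[mu]_x g (c - x)%R = \int[mu]_x g x)%E.
Proof.
have n1 : -1 != 0 :> R by rewrite oppr_eq0 oner_neq0.
move=> mg; have := integral_affine c n1 mg.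
rewrite normrN1 invr1 mul1e => <-.
by apply: eq_integral => x _; rewrite mulN1r.
Qed.

Lemma measurable_kernel2 q : measurable_fun [set: R] q ->
  measurable_fun [set: R * R] (fun z : R * R => q (z.1 - z.2)).
Proof.
move=> mq; apply: (measurableT_comp mq); exact: measurable_funB.
Qed.

Lemma normr_fine_le (x : \bar R) : (`|fine x|%:E <= `|x|)%E.
Proof. by case: x => [x||] //=; rewrite normr0 leey. Qed.

(** Positive and negative parts are integrated apart because Tonelli yields measurability without
    integrability. *)
Lemma measurable_convolution f q : measurable_fun [set: R] f ->
  measurable_fun [set: R] q -> measurable_fun [set: R] (convolution f q).
Proof.
move=> mf mq.
rewrite /convolution /Rintegral; apply: measurableT_comp => //.
pose G (z : R * R) : \bar R := ((f z.2 * q (z.1 - z.2)))%:E.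
have mG : measurable_fun [set: R * R] G.
  apply/measurable_EFinP; apply: measurable_funM; first exact: measurableT_comp.
  exact: measurable_kernel2.
have -> : (fun t => \int[mu]_y (f y * q (t - y))%:E)%E =
  ((fun t => \int[mu]_y (G^\+ (t, y))) \- (fun t => \int[mu]_y (G^\- (t, y))))%E.
  apply/funext => t; rewrite integralE; congr (_ - _)%E.
    by rewrite -[X in _ = X]/(\int[mu]_y (G^\+ \o (fun y => (t, y))) y)%E -funepos_comp.
  by rewrite -[X in _ = X]/(\int[mu]_y (G^\- \o (fun y => (t, y))) y)%E -funeneg_comp.
apply: emeasurable_funB.
  have := @measurable_fun_fubini_tonelli_F _ _ _ _ R mu (G^\+)%E.
  by apply => //; exact: measurable_funepos.
have := @measurable_fun_fubini_tonelli_F _ _ _ _ R mu (G^\-)%E.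
by apply => //; exact: measurable_funeneg.
Qed.

Section fubini.
Variables (f q P : R -> R) (M : R).
Hypothesis intf : mu.-integrable setT (EFin \o f).
Hypothesis mq : measurable_fun [set: R] q.
Hypothesis mP : measurable_fun [set: R] P.
Hypothesis qM : forall y, (\int[mu]_t `|P t * q (t - y)|%:E <= M%:E)%E.

Let F (z : R * R) : \bar R := (P z.1 * (f z.2 * q (z.1 - z.2)))%:E.

Let mf : measurable_fun [set: R] f.
Proof. by apply/measurable_EFinP; exact: measurable_int intf. Qed.

Let mF : measurable_fun [set: R * R] F.
Proof.
apply/measurable_EFinP; apply: measurable_funM.
  exact: measurableT_comp.
apply: measurable_funM; first exact: measurableT_comp.
exact: measurable_kernel2.
Qed.

(** Tonelli, integrating over [t] first: the bound [M], uniform in [y], leaves a multiple of |f|.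
    Bounding the product [P t * q (t - y)] rather than [P] lets [P] be either a bounded function or
    itself a singular kernel. *)
Let iF : (mu \x mu)%E.-integrable [set: R * R] F.
Proof.
apply/(@integrable21ltyP _ _ _ _ _ mu mu F mF).
apply: (@le_lt_trans _ _ (\int[mu]_y (M%:E * `|(f y)%:E|))%E).
  apply: ge0_le_integral => //.
  - by move=> y _; apply: integral_ge0.
  - apply: (@measurable_fun_fubini_tonelli_G _ _ (measurableTypeR R) (measurableTypeR R) R mu (abse \o F)).
      exact: measurableT_comp.
    by move=> z; exact: abse_ge0.
  - by apply: measurable_funeM; do 2 apply: measurableT_comp => //.
  move=> y _.
  under eq_integral => t _.
    rewrite /F /= mulrCA normrM EFinM.
    over.
  rewrite ge0_integralZl//.
  - by rewrite muleC lee_wpmul2r.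
  - apply/measurable_EFinP; apply: measurableT_comp => //; apply: measurable_funM => //.
    exact: measurable_translate.
rewrite ge0_integralZl//.
- move/integrableP : intf => [_ ioo].
  apply: lte_mul_pinfty => //.
  apply: le_trans (qM 0); exact: integral_ge0.
- by do 2 apply: measurableT_comp => //.
- apply: le_trans (qM 0); exact: integral_ge0.
Qed.

Let sectionE : ae_eq mu setT (fun t => \int[mu]_y F (t, y))%E
   (fun t => (P t * convolution f q t)%:E).
Proof.
have := ae_integrable1 iF; apply: filterS => t it _.
rewrite /F /= EFinM /convolution.
(* Integrability of the section of [F] gives that of [f y * q (t - y)] only after division by [P t];
   where [P t] vanishes both sides are 0. *)
have [P0|P0] := eqVneq (P t) 0.
  rewrite P0 mul0e; apply: integral0_eq => y _; by rewrite mul0r.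
have ig : mu.-integrable setT (EFin \o (fun y => f y * q (t - y))).
  have := integrableZl measurableT (P t)^-1 it.
  apply: eq_integrable => // y _ /=.
  by rewrite /F /= -EFinM mulKf.
under eq_integral do rewrite EFinM.
rewrite (integralZl measurableT ig) /Rintegral fineK//.
exact: integrable_fin_num.
Qed.

Lemma integrable_convolution :
  mu.-integrable setT (fun t => (P t * convolution f q t)%:E).
Proof.
have iFF := integrable_fubini_F iF.
have mc : measurable_fun [set: R] (fun t => (P t * convolution f q t)%:E).
  apply/measurable_EFinP; apply: measurable_funM => //.
  exact: measurable_convolution.
apply/integrableP; split => //.
have /integrableP[_] := iFF; apply: le_lt_trans.
rewrite le_eqVlt; apply/orP; left; apply/eqP.
apply: ge0_ae_eq_integral => //.
- exact: measurableT_comp.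
- by apply: measurableT_comp => //; exact: measurable_fubini_F iF.
- move: sectionE; apply: filterS => t /(_ Logic.I) <- _.
  by [].
Qed.

Let dualE y : (\int[mu]_t F (t, y) = (f y * \int[mu]_t (P t * q (t - y)))%:E)%E.
Proof.
have inner : mu.-integrable setT (EFin \o (fun t => P t * q (t - y))).
  apply/integrableP; split; last first.
    by apply: le_lt_trans (qM y) _; rewrite ltry.
  apply/measurable_EFinP; apply: measurable_funM => //; exact: measurable_translate.
rewrite /Rintegral EFinM fineK; last exact: integrable_fin_num inner.
rewrite -(integralZl measurableT inner).
by apply: eq_integral => t _; rewrite /F /= mulrCA -EFinM.
Qed.

Lemma integrable_convolution_dual :
  mu.-integrable setT (EFin \o (fun y => f y * \int[mu]_t (P t * q (t - y)))).
Proof.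
apply: (@le_integrable _ _ _ mu _ measurableT _ (fun y => M%:E * (f y)%:E)%E).
- apply: eq_measurable_fun (measurable_fubini_G iF) => y _.
  by rewrite /fubini_G dualE.
- move=> y _; rewrite /= lee_fin !normrM mulrC ler_wpM2r//.
  have M0 : 0 <= M by rewrite -lee_fin; apply: le_trans (qM 0); exact: integral_ge0.
  rewrite (ger0_norm M0) -lee_fin.
  apply: le_trans (qM y).
  apply: le_trans (normr_fine_le _) _.
  apply: le_trans (le_abse_integral _ _ _) _ => //.
  apply/measurable_EFinP; apply: measurable_funM => //; exact: measurable_translate.
- exact: integrableZl.
Qed.

Lemma convolution_fubini :
  \int[mu]_t (P t * convolution f q t) = \int[mu]_y (f y * \int[mu]_t (P t * q (t - y))).
Proof.
rewrite [LHS]/Rintegral [RHS]/Rintegral.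
have -> : (\int[mu]_t (P t * convolution f q t)%:E = \int[mu]_t \int[mu]_y F (t, y))%E.
  apply: ae_eq_integral => //.
  - exact: measurable_int integrable_convolution.
  - exact: measurable_fubini_F iF.
  - by move: sectionE; apply: filterS => t /(_ Logic.I) <- _.
rewrite (Fubini iF).
by apply: (congr1 fine); apply: eq_integral => y _; exact: dualE.
Qed.

End fubini.

Section young.
Variables (f k : R -> R) (p : R).
Hypothesis p1 : 1 <= p.
Hypothesis mf : measurable_fun [set: R] f.
Hypothesis intk : mu.-integrable setT (EFin \o k).
Hypothesis k0 : forall x, 0 <= k x.

Let mk : measurable_fun [set: R] k.
Proof. by apply/measurable_EFinP; exact: measurable_int intk. Qed.

Let K : R := \int[mu]_x k x.

Let KE : (K%:E = \int[mu]_x (k x)%:E)%E.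
Proof. by rewrite /K /Rintegral fineK//; exact: integrable_fin_num. Qed.

Let K0 : 0 <= K.
Proof. by apply: Rintegral_ge0 => x _; exact: k0. Qed.

Let sectionK x : (\int[mu]_y (k (x - y))%:E = K%:E)%E.
Proof.
rewrite KE; apply: (@integral_reflect (fun t => (k t)%:E) x).
exact/measurable_EFinP.
Qed.

Let msec x : measurable_fun [set: R] (fun y => k (x - y)).
Proof. exact: measurable_reflect. Qed.

Let p0 : 0 < p. Proof. exact: lt_le_trans ltr01 p1. Qed.

Let normr_convolution x :
  (`|convolution f k x|%:E <= \int[mu]_y (`|f y| * k (x - y))%:E)%E.
Proof.
apply: le_trans (normr_fine_le _) _.
apply: le_trans.
  apply: le_abse_integral => //; apply/measurable_EFinP.
  by apply: measurable_funM => //; exact: msec.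
rewrite le_eqVlt; apply/orP; left; apply/eqP; apply: eq_integral => y _.
by rewrite abse_EFin normrM (ger0_norm (k0 _)).
Qed.

(* Hoelder's inequality with the kernel split as k^(1/p) k^(1/q). *)
Let jensen x : ((`|convolution f k x| `^ p)%:E <=
  (K `^ (p - 1))%:E * \int[mu]_y (`|f y| `^ p * k (x - y))%:E)%E.
Proof.
(* For [p = 1] the conjugate exponent is infinite, and the claim is [normr_convolution] itself. *)
have [->|pn1] := eqVneq p 1.
  rewrite subrr powRr0 mul1e powRr1//.
  apply: le_trans (normr_convolution x) _.
  rewrite le_eqVlt; apply/orP; left; apply/eqP; apply: eq_integral => y _.
  by rewrite powRr1.
have {}pn1 : 0 < p - 1 by rewrite subr_gt0 lt_neqAle eq_sym pn1.
pose q := p / (p - 1).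
have q0 : 0 < q by rewrite divr_gt0.
have pq : p^-1 + q^-1 = 1.
  rewrite /q invf_div; field.
  by rewrite !gt_eqF.
pose F y := `|f y| * k (x - y) `^ p^-1.
pose G y := k (x - y) `^ q^-1.
have mF : measurable_fun [set: R] F.
  apply: measurable_funM; first exact: measurableT_comp.
  by apply: (measurableT_comp (measurable_powR _)); exact: msec.
have mG : measurable_fun [set: R] G.
  by apply: (measurableT_comp (measurable_powR _)); exact: msec.
have FG y : F y * G y = `|f y| * k (x - y).
  by rewrite /F /G -mulrA -powRD pq ?oner_eq0// powRr1.
have := @hoelder _ _ _ mu F G p q mF mG p0 q0 pq.
have -> : ('N[mu]_1[EFin \o (F \* G)%R] = \int[mu]_y (`|f y| * k (x - y))%:E)%E.
  rewrite Lnorm1; apply: eq_integral => y _ /=.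
  by rewrite FG ger0_norm// mulr_ge0.
move=> /(le_trans (normr_convolution x)) /(@gt0_ler_poweR _ p (ltW p0)).
rewrite !in_itv/= !leey !andbT => /(_ (normr_ge0 _) (mule_ge0 (Lnorm_ge0 _ _ _) (Lnorm_ge0 _ _ _))).
rewrite poweRM ?Lnorm_ge0// => /le_trans; apply.
rewrite (poweR_Lnorm _ _ (lt0r_neq0 p0)).
have -> : ('N[mu]_q%:E[EFin \o G] `^ p = (K `^ (p - 1))%:E)%E.
  have eqp : p = q * (p - 1) by rewrite /q divfK// gt_eqF.
  rewrite {1}eqp.
  rewrite poweRrM (poweR_Lnorm _ _ (lt0r_neq0 q0)).
  have -> : (\int[mu]_y (`|(EFin \o G) y| `^ q) = K%:E)%E.
    rewrite -(sectionK x); apply: eq_integral => y _ /=.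
    rewrite ger0_norm ?powR_ge0// /G -powRrM mulVf ?gt_eqF// powRr1//.
  by [].
rewrite muleC le_eqVlt; apply/orP; left; apply/eqP; congr (_ * _)%E.
apply: eq_integral => y _ /=.
rewrite ger0_norm ?mulr_ge0 ?powR_ge0// /F powRM ?powR_ge0//.
by rewrite -powRrM mulVf ?gt_eqF// powRr1.
Qed.

(** Integrate [jensen] over x: after Tonelli, translation invariance turns the inner integral of the
    kernel into [K], and K^(p-1) K = K^p. The p-th root leaves the constant [K], free of p. The norm
    of [f] may be infinite. *)
Lemma young_convolution :
  ('N[mu]_p%:E[EFin \o convolution f k] <=
   (\int[mu]_x k x)%:E * 'N[mu]_p%:E[EFin \o f])%E.
Proof.
rewrite -/K.
have mfp : measurable_fun [set: R] (fun y => `|f y| `^ p).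
  by apply: (measurableT_comp (measurable_powR _)); exact: measurableT_comp.
have main : (\int[mu]_x (`|convolution f k x| `^ p)%:E <=
    (K `^ p)%:E * \int[mu]_x (`|f x| `^ p)%:E)%E.
  pose H (z : R * R) := (`|f z.2| `^ p * k (z.1 - z.2))%:E.
  have mH : measurable_fun [set: R * R] H.
    apply/measurable_EFinP; apply: measurable_funM; first exact: (measurableT_comp mfp).
    exact: measurable_kernel2.
  have H0 z : (0%R <= H z)%E by rewrite lee_fin mulr_ge0// powR_ge0.
  have mH1 := @measurable_fun_fubini_tonelli_F _ _ (measurableTypeR R)
    (measurableTypeR R) R mu H mH H0.
  apply: (@le_trans _ _ (\int[mu]_x ((K `^ (p - 1))%:E * \int[mu]_y H (x, y)))%E).
    apply: ge0_le_integral => //.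
    - apply/measurable_EFinP; apply: (measurableT_comp (measurable_powR _)).
      by apply: measurableT_comp => //; exact: measurable_convolution.
    - exact: measurable_funeM.
  rewrite ge0_integralZl//; last 2 first.
  - by move=> x _; apply: integral_ge0.
  - by rewrite lee_fin powR_ge0.
  rewrite (@fubini_tonelli _ _ (measurableTypeR R)
    (measurableTypeR R) R mu mu H mH H0).
  have -> : (\int[mu]_y \int[mu]_x H (x, y) = K%:E * \int[mu]_x (`|f x| `^ p)%:E)%E.
    rewrite -ge0_integralZl//; last exact/measurable_EFinP.
    apply: eq_integral => y _; rewrite /H /=.
    under eq_integral do rewrite EFinM.
    rewrite ge0_integralZl ?lee_fin ?powR_ge0//.
    + rewrite muleC; congr (_ * _)%E; rewrite KE.
      apply: (@integral_translate (fun t => (k t)%:E) y).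
      exact/measurable_EFinP.
    + apply/measurable_EFinP; exact: measurable_translate.
    + by move=> t _; rewrite lee_fin.
  by rewrite muleA -EFinM mulrC mulr_powRB1.
rewrite unlock /Lnorm.
have e g : (\int[mu]_x (`|(EFin \o g) x| `^ p) = \int[mu]_x (`|g x| `^ p)%:E)%E.
  by apply: eq_integral.
rewrite !e.
have {1}-> : K = (K `^ p) `^ p^-1 by rewrite -powRrM mulfV ?gt_eqF// powRr1.
rewrite -poweR_EFin -poweRM ?lee_fin ?powR_ge0//; last first.
  by apply: integral_ge0 => x _; rewrite lee_fin powR_ge0.
apply: gt0_ler_poweR => //.
- by rewrite invr_ge0 ltW.
- rewrite in_itv/= leey andbT; apply: integral_ge0 => x _; rewrite lee_fin powR_ge0//.
- rewrite in_itv/= leey andbT mule_ge0 ?lee_fin ?powR_ge0//.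
  by apply: integral_ge0 => x _; rewrite lee_fin powR_ge0.
Qed.

End young.

End convolution.

(** * Power kernels, and the beta and gamma integrals *)

Section power_kernel.
Context {R : realType}.
Local Notation mu := (@lebesgue_measure R).
Implicit Types (s r L : R).

(* Convolved with functions supported in ]a, b[ and evaluated in ]a, b[, the
   truncation at L = b - a is invisible, but it makes the kernel integrable. *)
Definition power_kernel s L : R -> R := (fun x => x `^ (s - 1)) \_ `]0, L[.

Lemma power_kernel_ge0 s L x : 0 <= power_kernel s L x.
Proof. by rewrite /power_kernel patchE; case: ifP => // _; exact: powR_ge0. Qed.

Lemma measurable_power_kernel s L : measurable_fun [set: R] (power_kernel s L).
Proof.
apply/(measurable_restrictT _ _).1; first exact: measurable_itv.
by apply: (measurable_funS _ _ (measurable_powR _)).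
Qed.

Lemma power_kernelE s L x : 0 < x < L -> power_kernel s L x = x `^ (s - 1).
Proof. by move=> xL; rewrite /power_kernel patchE mem_set //= in_itv. Qed.

Lemma power_kernel0 s L x : ~~ (0 < x < L) -> power_kernel s L x = 0.
Proof.
by move=> xL; rewrite /power_kernel patchE memNset //= in_itv/=; exact/negP.
Qed.

Lemma integral_powR_le s e L : 0 < s -> 0 < e -> e < L ->
  (\int[mu]_(x in `[e, L]) (x `^ (s - 1))%:E <= (L `^ s / s)%:E)%E.
Proof.
move=> s0 e0 eL.
pose F (x : R) := x `^ s / s.
have dF (x : R) : 0 < x -> is_derive x 1 F (x `^ (s - 1)).
  move=> x0; have := is_derive1_powR s x0 => d.
  have -> : x `^ (s - 1) = s^-1 *: (s * x `^ (s - 1)).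
    by rewrite /GRing.scale/= mulKf// gt_eqF.
  rewrite /F.
  have -> : (fun x => x `^ s / s) = s^-1 \*: (fun x => x `^ s).
    by apply/funext => y; rewrite /= /GRing.scale/= mulrC.
  exact: is_deriveZ.
have cF (x : R) : 0 < x -> {for x, continuous F}.
  move=> x0; apply: differentiable_continuous; apply/derivable1_diffP.
  by case: (dF x x0).
rewrite (@continuous_FTC2 _ _ F)//.
- rewrite -EFinB lee_fin /F lerBlDr lerDl divr_ge0 ?powR_ge0// ltW//.
- apply: continuous_in_subspaceT => x; rewrite inE/= in_itv/= => /andP[ex _].
  have x0 : 0 < x by exact: lt_le_trans ex.
  apply: differentiable_continuous; apply/derivable1_diffP.
  by apply: derivable_powR; rewrite in_itv/= x0.
- split.
  + move=> x; rewrite in_itv/= => /andP[ex _]; have x0 : 0 < x by exact: lt_trans ex.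
    by case: (dF x x0).
  + by apply: cvg_at_right_filter; exact: cF.
  + by apply: cvg_at_left_filter; apply: cF; exact: lt_trans eL.
- move=> x; rewrite in_itv/= => /andP[ex _]; have x0 : 0 < x by exact: lt_trans ex.
  by rewrite derive1E; case: (dF x x0).
Qed.

(** The singularity at 0 is approached through the intervals [[1/(n+1), L]], on which the integrals
    stay below [L^s / s]; monotone convergence passes to the limit. *)
Lemma power_kernel_integrable s L : 0 < s ->
  mu.-integrable setT (EFin \o power_kernel s L).
Proof.
move=> s0.
have [L0|L0] := leP L 0.
  have -> : power_kernel s L = cst 0.
    apply/funext => x; apply: power_kernel0; apply/negP => /andP[x0 xL].
    by have := lt_trans x0 xL; rewrite ltNge L0.
  exact: integrable0.
apply/integrableP; split; first by apply/measurable_EFinP; exact: measurable_power_kernel.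
under eq_integral do rewrite /= ger0_norm ?power_kernel_ge0//.
rewrite /power_kernel.
under eq_integral do rewrite -[(_ _)%:E]/((EFin \o _) _) -restrict_EFin.
rewrite -integral_mkcond.
pose F n : set R := `[n.+1%:R^-1, L]%classic.
apply: (@le_lt_trans _ _ (\int[mu]_(x in \bigcup_n F n) (x `^ (s - 1))%:E)%E).
  apply: ge0_subset_integral => //.
  - by apply: bigcup_measurable => n _; exact: measurable_itv.
  - apply/measurable_EFinP; exact: (measurable_funS _ _ (measurable_powR _)).
  - by move=> x _; rewrite lee_fin powR_ge0.
  - move=> x /=; rewrite in_itv/= => /andP[x0 xL].
    exists (Num.truncn x^-1) => //; rewrite /F/= in_itv/= (ltW xL) andbT.
    rewrite invf_ple ?posrE//.
    exact/ltW/truncnS_gt.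
have := @ge0_nondecreasing_set_cvg_integral _ (measurableTypeR R) _ F (fun x => (x `^ (s - 1))%:E) mu.
have ndF : {homo F : n m / (n <= m)%N >-> (n <= m)%O}.
  move=> n m nm; apply/subsetPset => x; rewrite /F/= !in_itv/= => /andP[nx ->].
  by rewrite andbT (le_trans _ nx)// lef_pV2 ?posrE// ler_nat.
move=> /(_ ndF (fun=> measurable_itv _)) h.
have {}h := h (fun i => (measurable_EFinP _ _).2 (measurable_funS measurableT (@subsetT _ _) (measurable_powR _))) (fun i x _ => powR_ge0 _ _).
rewrite -(cvg_lim _ h)//.
apply: (@le_lt_trans _ _ (L `^ s / s)%:E); last exact: ltry.
apply: lime_le.
  by apply/cvg_ex; eexists; exact: h.
apply: nearW => n.
have n0 : 0 < n.+1%:R^-1 :> R by rewrite invr_gt0.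
have [nL|Ln] := ltP n.+1%:R^-1 L; first exact: integral_powR_le.
rewrite /F; have [nL|nL] := eqVneq n.+1%:R^-1 L.
  rewrite nL set_itv1 integral_set1 lee_fin divr_ge0 ?powR_ge0// ltW//.
rewrite set_itv_ge ?integral_set0 ?lee_fin ?divr_ge0 ?powR_ge0 ?ltW//.
by rewrite bnd_simp -ltNge lt_neqAle eq_sym nL.
Qed.

(** The kernel without truncation: it is homogeneous under dilations, which [power_kernel] is not
    and which the beta integral requires. *)
Definition half_power s : R -> R := (fun x => x `^ (s - 1)) \_ `]0, +oo[.

Lemma half_power_ge0 s x : 0 <= half_power s x.
Proof. by rewrite /half_power patchE; case: ifP => // _; exact: powR_ge0. Qed.

Lemma measurable_half_power s : measurable_fun [set: R] (half_power s).
Proof.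
apply/(measurable_restrictT _ _).1; first exact: measurable_itv.
by apply: (measurable_funS _ _ (measurable_powR _)).
Qed.

Lemma half_powerE s x : 0 < x -> half_power s x = x `^ (s - 1).
Proof. by move=> x0; rewrite /half_power patchE mem_set //= in_itv/= x0. Qed.

Lemma half_power0 s x : x <= 0 -> half_power s x = 0.
Proof.
by move=> x0; rewrite /half_power patchE memNset //= in_itv/= andbT; apply/negP; rewrite -leNgt.
Qed.

(** Euler's B(s, 1 - s): the zero values of [half_power] confine the integral to []0, 1[]. It is
    extended-real so that it can be manipulated before it is known to be finite. *)
Definition ebeta s : \bar R := \int[mu]_x (half_power s x * half_power (1 - s) (1 - x))%:E.

Lemma measurable_beta s (r : R) :
  measurable_fun [set: R] (fun x => half_power s x * half_power (1 - s) (r - x)).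
Proof.
apply: measurable_funM; first exact: measurable_half_power.
exact: (@measurable_reflect _ (half_power (1 - s)) r (measurable_half_power _)).
Qed.

Lemma EFin_mulVI (r : R) (x y : \bar R) : r != 0 ->
  ((r^-1)%:E * x = (r^-1)%:E * y)%E -> x = y.
Proof.
move=> r0 /(congr1 (fun z => r%:E * z)%E).
by rewrite !muleA -EFinM mulfV// !mul1e.
Qed.

(** The integrand is homogeneous of degree (s - 1) + (1 - s - 1) = -1, which exactly cancels the
    Jacobian of the dilation by [r]. This independence of [r] is why fractional integrals of orders
    s and 1 - s compose to a plain primitive. *)
Lemma beta_homogeneous s (r : R) : 0 < r ->
  (\int[mu]_x (half_power s x * half_power (1 - s) (r - x))%:E = ebeta s)%E.
Proof.
move=> r0.
have r0' : r != 0 by rewrite gt_eqF.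
have mg := (measurable_EFinP _ _).2 (measurable_beta s r).
have := integral_affine 0 r0' mg.
rewrite (gtr0_norm r0) => h.
have {h} : (\int[mu]_x (half_power s (r * x) * half_power (1 - s) (r - r * x))%:E =
  (r^-1)%:E * \int[mu]_x (half_power s x * half_power (1 - s) (r - x))%:E)%E.
  by rewrite -h; apply: eq_integral => x _; rewrite /= add0r.
have -> : (\int[mu]_x (half_power s (r * x) * half_power (1 - s) (r - r * x))%:E =
  (r^-1)%:E * ebeta s)%E.
  rewrite /ebeta -ge0_integralZl//.
  - apply: eq_integral => x _; rewrite -EFinM; congr EFin.
    have [x0|x0] := leP x 0.
      have rx0 : r * x <= 0 by rewrite pmulr_rle0.
      by rewrite (half_power0 _ rx0) (half_power0 _ x0) !mul0r mulr0.
    have [x1|x1] := leP 1 x.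
      rewrite ![half_power (1 - s) _]half_power0 ?mulr0//.
        by rewrite subr_le0.
      by rewrite subr_le0 ler_peMr// ltW.
    have rx : 0 < r * x by rewrite mulr_gt0.
    have x1' : 0 < 1 - x by rewrite subr_gt0.
    rewrite -{2}(mulr1 r) -mulrBr !half_powerE// ?mulr_gt0//.
    rewrite !powRM ?(ltW r0) ?(ltW x0) ?(ltW x1')// mulrACA -powRD ?r0' ?implybT//.
    by rewrite (_ : s - 1 + (1 - s - 1) = -1) ?powR_inv1 ?(ltW r0)//; ring.
  - by apply/measurable_EFinP; exact: measurable_beta.
  - by move=> x _; rewrite lee_fin mulr_ge0// half_power_ge0.
  - by rewrite lee_fin invr_ge0 ltW.
by move=> /(EFin_mulVI r0')/esym.
Qed.

Lemma beta_convolution s (x y : R) : y < x ->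
  (\int[mu]_t (half_power s (x - t) * half_power (1 - s) (t - y))%:E = ebeta s)%E.
Proof.
move=> yx; have xy0 : 0 < x - y by rewrite subr_gt0.
apply: etrans (beta_homogeneous s xy0).
rewrite -(@integral_reflect _ (fun t => (half_power s t * half_power (1 - s) (x - y - t))%:E) x).
  by apply: eq_integral => t _; congr (EFin (_ * half_power _ _)); ring.
by apply/measurable_EFinP; exact: measurable_beta.
Qed.

Definition egamma s : \bar R := \int[mu]_x (half_power s x * expR (- x))%:E.

Lemma measurable_gamma_integrand s :
  measurable_fun [set: R] (fun x => half_power s x * expR (- x)).
Proof.
apply: measurable_funM; first exact: measurable_half_power.
by apply: measurableT_comp => //; exact: measurableT_comp.
Qed.

Lemma GammaE s : Gamma s = fine (egamma s).
Proof.
rewrite /Gamma /egamma Rintegral_mkcond /Rintegral; congr fine.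
apply: eq_integral => x _; rewrite /half_power !patchE.
by case: ifP => //; rewrite mul0r.
Qed.

Lemma integral_expRN : (\int[mu]_(x in `]0%R, +oo[) (expR (- x))%:E = 1)%E.
Proof.
have h : measurable_fun [set: R] (fun x : R => expR (- x)).
  by apply: measurableT_comp => //; exact: measurableT_comp.
have d (x : R) : is_derive x (1 : R) (fun x : R => - expR (- x)) (expR (- x)).
  apply: is_derive_eq.
  by rewrite mulrN1 opprK.
rewrite integral_itv_obnd_cbnd; last first.
  by apply/measurable_EFinP; exact: measurable_funS h.
rewrite (@ge0_continuous_FTC2y _ _ (fun x => - expR (- x)) _ 0)//.
- by rewrite oppr0 expR0 EFinN oppeK add0e.
- apply: continuous_subspaceT => x.
  apply: continuous_comp; first exact: opp_continuous.
  exact: continuous_expR.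
- rewrite -[X in _ --> X]oppr0; apply: cvgN; exact: cvgr_expR.
- apply: cvg_at_right_filter; apply: cvgN; apply: continuous_comp; first exact: opp_continuous.
  exact: continuous_expR.
- by move=> x _; rewrite derive1E; case: (d x).
Qed.

(** Putting r = x + y in the product gives the beta integrand of length r times exp(-r). By
    [beta_homogeneous] the inner integral is the same for all r > 0, and exp(-r) has integral 1. The
    integrands are nonnegative, so Tonelli suffices and nothing has to converge. *)
Lemma gamma_reflection s : (egamma s * egamma (1 - s) = ebeta s)%E.
Proof.
pose H (z : R * R) := (half_power s z.1 * half_power (1 - s) (z.2 - z.1) * expR (- z.2))%:E.
have mh := measurable_half_power.
have mH : measurable_fun [set: R * R] H.
  apply/measurable_EFinP; apply: measurable_funM; last first.
    by apply: measurableT_comp => //; exact: measurableT_comp.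
  apply: measurable_funM; first exact: (measurableT_comp (mh _)).
  by apply: (measurableT_comp (mh _)); exact: measurable_funB.
have H0 z : (0 <= H z)%E by rewrite lee_fin !mulr_ge0// ?half_power_ge0// expR_ge0.
transitivity (\int[mu]_x \int[mu]_r H (x, r))%E.
  have eg0 : (0 <= egamma (1 - s))%E.
    by apply: integral_ge0 => x _; rewrite lee_fin mulr_ge0// ?half_power_ge0// expR_ge0.
  rewrite {1}/egamma -ge0_integralZr//; last 2 first.
  - by apply/measurable_EFinP; exact: measurable_gamma_integrand.
  - by move=> x _; rewrite lee_fin mulr_ge0// ?half_power_ge0// expR_ge0.
  apply: eq_integral => x _; rewrite /egamma.
  rewrite -(@integral_translate _ (fun t => (half_power (1 - s) t * expR (- t))%:E) x); last first.
    by apply/measurable_EFinP; exact: measurable_gamma_integrand.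
  rewrite -ge0_integralZl//.
  - apply: eq_integral => r _; rewrite /H -EFinM; congr EFin => /=.
    rewrite mulrACA -expRD; congr (_ * expR _); ring.
  - apply/measurable_EFinP; apply: (@measurable_translate _ (fun t => half_power (1 - s) t * expR (- t))).
    exact: measurable_gamma_integrand.
  - by move=> r _; rewrite lee_fin mulr_ge0// ?half_power_ge0// expR_ge0.
  - by rewrite lee_fin mulr_ge0// ?half_power_ge0// expR_ge0.
rewrite (@fubini_tonelli _ _ (measurableTypeR R) (measurableTypeR R) R mu mu H mH H0).
have inner r : (\int[mu]_x H (x, r) = (ebeta s * (expR (- r))%:E) * (\1_(`]0%R, +oo[%classic : set R) r)%:E)%E.
  rewrite /H /=; under eq_integral do rewrite EFinM.
  rewrite ge0_integralZr//.
  - have [r0|r0] := ltP 0 r.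
      by rewrite beta_homogeneous// indicE mem_set ?mule1//= in_itv/= r0.
    rewrite indicE memNset ?mule0//=; last by rewrite in_itv/= andbT; apply/negP; rewrite -leNgt.
    rewrite integral0_eq ?mul0e// => x _.
    have [x0|x0] := leP x 0; first by rewrite half_power0// mul0r.
    by rewrite [X in _ * X]half_power0 ?mulr0// subr_le0 (le_trans r0) ?ltW.
  - by apply/measurable_EFinP; exact: measurable_beta.
  - by move=> x _; rewrite lee_fin mulr_ge0// half_power_ge0.
under eq_integral => r _ do rewrite inner -muleA.
rewrite ge0_integralZl//.
- under eq_integral do rewrite muleC.
  rewrite -[RHS]mule1 -[in RHS]integral_expRN [in RHS]integral_mkcond; congr (_ * _)%E.
  apply: eq_integral => x _; rewrite patchE indicE.
  by case: ifP => _; rewrite ?mul1e ?mul0e.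
- apply: emeasurable_funM.
    by apply/measurable_EFinP; apply: measurableT_comp => //; exact: measurableT_comp.
  by apply/measurable_EFinP; exact: measurable_indic.
- by apply: integral_ge0 => x _; rewrite lee_fin mulr_ge0// half_power_ge0.
Qed.

(** The two factors are singular at opposite ends of []0, 1[]: on each half one of them is at most 2
    and the other is integrable. *)
Lemma ebeta_lty s : 0 < s < 1 -> (ebeta s < +oo)%E.
Proof.
move=> /andP[s0 s1].
have s1' : 0 < 1 - s by rewrite subr_gt0.
have ik := power_kernel_integrable 1 s0.
have ik' := power_kernel_integrable 1 s1'.
have mk' := (measurable_EFinP _ _).2 (measurable_power_kernel (1 - s) 1).
apply: (@le_lt_trans _ _ (\int[mu]_x (2%:E * ((power_kernel s 1 x)%:E +
   (power_kernel (1 - s) 1 (1 - x))%:E)))%E).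
  apply: ge0_le_integral => //.
  - by move=> x _; rewrite lee_fin mulr_ge0// half_power_ge0.
  - by apply/measurable_EFinP; exact: measurable_beta.
  - apply: measurable_funeM; apply: emeasurable_funD.
      by apply/measurable_EFinP; exact: measurable_power_kernel.
    apply/measurable_EFinP; apply: (@measurable_reflect _ (power_kernel (1 - s) 1)).
    exact: measurable_power_kernel.
  - move=> x _; rewrite -EFinD -EFinM lee_fin.
    have [x0|x0] := leP x 0.
      by rewrite half_power0// mul0r mulr_ge0// addr_ge0// power_kernel_ge0.
    have [x1|x1] := leP 1 x.
      rewrite [X in _ * X]half_power0 ?subr_le0// mulr0.
      by rewrite mulr_ge0// addr_ge0// power_kernel_ge0.
    have x1' : 0 < 1 - x by rewrite subr_gt0.
    rewrite !half_powerE// !power_kernelE ?x0 ?x1//; last by rewrite x1' ltrBlDr ltrDl.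
    (* A factor away from its singularity: y^(t-1) <= y^-1 <= 2. *)
    have bnd (y t : R) : 2^-1 <= y -> y < 1 -> 0 < t < 1 -> y `^ (t - 1) <= 2.
      move=> y2 y1 /andP[t0 t1].
      have y0 : 0 < y by apply: lt_le_trans y2; rewrite invr_gt0.
      rewrite -opprB powRN; apply: (@le_trans _ _ y^-1); last first.
        by rewrite invf_ple ?posrE.
      rewrite lef_pV2 ?posrE ?powR_gt0//.
      apply: ger1_powR; first by rewrite y0 ltW.
      by rewrite lerBlDr lerDl ltW.
    have [x2|x2] := leP x 2^-1.
      apply: (@le_trans _ _ (2 * x `^ (s - 1))).
        rewrite [leRHS]mulrC ler_wpM2l ?powR_ge0//; apply: bnd.
        - by lra.
        - by lra.
        - by rewrite s1' ltrBlDr ltrDl.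
      by rewrite ler_pM2l// lerDl powR_ge0.
    apply: (@le_trans _ _ (2 * (1 - x) `^ (1 - s - 1))).
      rewrite ler_wpM2r ?powR_ge0//; apply: bnd => //.
      - exact: ltW.
      - by rewrite s0.
    by rewrite ler_pM2l// lerDr powR_ge0.
rewrite ge0_integralZl//; last 2 first.
- apply: emeasurable_funD.
    by apply/measurable_EFinP; exact: measurable_power_kernel.
  apply/measurable_EFinP; apply: (@measurable_reflect _ (power_kernel (1 - s) 1)).
  exact: measurable_power_kernel.
- by move=> x _; rewrite adde_ge0// lee_fin power_kernel_ge0.
rewrite ge0_integralD//; first last.
- apply/measurable_EFinP; apply: (@measurable_reflect _ (power_kernel (1 - s) 1)).
  exact: measurable_power_kernel.
- by move=> x _; rewrite lee_fin power_kernel_ge0.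
- by apply/measurable_EFinP; exact: measurable_power_kernel.
- by move=> x _; rewrite lee_fin power_kernel_ge0.
rewrite (@integral_reflect _ (fun t => (power_kernel (1 - s) 1 t)%:E) 1)//.
apply: lte_mul_pinfty => //.
apply: lte_add_pinfty; rewrite ltey_eq.
  by rewrite (integrable_fin_num measurableT ik).
by rewrite (integrable_fin_num measurableT ik').
Qed.

(** Both exponents are negative, so the integrand is at least 1 on []0, 1[]. A positive lower bound
    is what rules out vanishing gamma integrals below. *)
Lemma ebeta_ge1 s : 0 < s < 1 -> (1 <= ebeta s)%E.
Proof.
move=> /andP[s0 s1].
have -> : 1%E = (\int[mu]_x (\1_(`]0, 1[%classic : set R) x)%:E)%E.
  rewrite integral_indic// setIT.
  have := @lebesgue_measure_itv R `]0, 1[.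
  by rewrite /= lte_fin ltr01 oppr0 adde0 => <-.
apply: ge0_le_integral => //.
- by apply/measurable_EFinP; exact: measurable_indic.
- by apply/measurable_EFinP; exact: measurable_beta.
- move=> x _; rewrite lee_fin indicE.
  have [|_] := boolP (x \in `]0, 1[%classic); last by rewrite mulr_ge0// half_power_ge0.
  rewrite inE/= in_itv/= => /andP[x0 x1].
  have x1' : 0 < 1 - x by rewrite subr_gt0.
  rewrite !half_powerE//.
  have bnd (y t : R) : 0 < y < 1 -> t < 0 -> 1 <= y `^ t.
    move=> /andP[y0 y1] t0; rewrite -(opprK t) powRN invf_ge1 ?powR_gt0//.
    rewrite -(powRr0 y); apply: ger_powR; first by rewrite y0 ltW.
    by rewrite oppr_ge0 ltW.
  rewrite -[X in X <= _](mulr1 1) ler_pM//.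
  - by apply: bnd; rewrite ?x0// subr_lt0.
  - by apply: bnd; rewrite ?x1' ?ltrBlDr ?ltrDl//; lra.
Qed.

(** Two nonnegative extended reals whose product lies in [[1, +oo[] are both finite and positive: a
    zero factor would give 0, an infinite one +oo. No gamma integral has to be estimated. *)
Lemma Gamma_gt0_ebeta s : 0 < s < 1 ->
  0 < Gamma s /\ (ebeta s = (Gamma s * Gamma (1 - s))%:E)%E.
Proof.
move=> s01; have := gamma_reflection s.
have Blt := ebeta_lty s01; have Bge := ebeta_ge1 s01.
have eg0 t : (0 <= egamma t)%E.
  by apply: integral_ge0 => x _; rewrite lee_fin mulr_ge0// ?half_power_ge0// expR_ge0.
have := eg0 s; have := eg0 (1 - s).
rewrite !GammaE; move: (egamma s) (egamma (1 - s)) (ebeta s) Blt Bge.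
move=> [x||] [y||] [z||] //=.
- by move=> _; rewrite !lee_fin => z1 y0 x0 [xyz]; rewrite -xyz; split => //; nra.
- move=> _ z1 _ x0; rewrite lee_fin in x0.
  have [->|xn0] := eqVneq x 0; first by rewrite mul0e => -[z0]; move: z1; rewrite -z0 lee_fin ler10.
  by rewrite mulry gtr0_sg ?mul1e// lt_neqAle eq_sym xn0.
- move=> _ z1 y0 _; rewrite lee_fin in y0.
  have [->|xn0] := eqVneq y 0; first by rewrite mule0 => -[z0]; move: z1; rewrite -z0 lee_fin ler10.
  by rewrite mulyr gtr0_sg ?mul1e// lt_neqAle eq_sym xn0.
Qed.

Lemma Gamma_gt0 s : 0 < s < 1 -> 0 < Gamma s.
Proof. by move=> /Gamma_gt0_ebeta[]. Qed.

Lemma beta_kernel s (x y : R) : 0 < s < 1 -> y < x ->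
  (\int[mu]_t (half_power s (x - t) * half_power (1 - s) (t - y))%:E =
  (Gamma s * Gamma (1 - s))%:E)%E.
Proof. by move=> s01 yx; rewrite beta_convolution// (Gamma_gt0_ebeta s01).2. Qed.

End power_kernel.

(** * Smooth functions and a smooth positive part *)

Section smooth_functions.
Context {R : realType}.
Implicit Types (f g df : R -> R) (x c d : R).

Definition smooth f := forall n x, derivable (derive1n n f) x 1.

(** [derive1n] adds derivatives on the outside, whereas the product and chain rules are applied to
    the first derivative; peeling that one off makes each closure property an induction with [f]
    generalised. *)
Fixpoint Ck (n : nat) f : Prop :=
  if n is m.+1 then (forall x, derivable f x 1) /\ Ck m (derive1 f) else True.

Lemma derive1nSr n f : derive1n n.+1 f = derive1n n (derive1 f).
Proof. by rewrite /derive1n iterSr. Qed.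

Lemma smoothP f : smooth f <-> forall n, Ck n f.
Proof.
split.
  move=> sf n; elim: n f sf => [//|n IH] f sf; split; first exact: (sf 0%N).
  by apply: IH => m x; rewrite -derive1nSr; exact: sf.
move=> cf n; elim: n f cf => [|n IH] f cf x; first by case: (cf 1%N).
by rewrite derive1nSr; apply: IH => m; case: (cf m.+1).
Qed.

Lemma smooth_derive1 f : smooth f -> smooth (derive1 f).
Proof. by move=> sf n x; rewrite -derive1nSr; exact: sf. Qed.

Lemma smooth_derivable f x : smooth f -> derivable f x 1.
Proof. by move=> /(_ 0%N x). Qed.

Lemma is_derive1 f x : derivable f x 1 -> is_derive x 1 f ((derive1 f) x).
Proof. by move=> df; apply: DeriveDef => //; rewrite derive1E. Qed.

Lemma smooth_is_derive f x : smooth f -> is_derive x 1 f ((derive1 f) x).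
Proof. by move=> sf; apply: is_derive1; exact: smooth_derivable. Qed.

Lemma derive1P f (df : R -> R) : (forall x, is_derive x 1 f (df x)) -> (derive1 f) = df.
Proof. by move=> h; apply/funext => x; rewrite derive1E; case: (h x). Qed.

Lemma CkW n f : Ck n.+1 f -> Ck n f.
Proof. by elim: n f => [//|n IH] f [df cf]; split => //; exact: IH. Qed.

Lemma Ck_is_derive n f x : Ck n.+1 f -> is_derive x 1 f ((derive1 f) x).
Proof. by move=> [df _]; exact: is_derive1. Qed.

Lemma CkS n f df : (forall x, is_derive x 1 f (df x)) -> Ck n df -> Ck n.+1 f.
Proof.
by move=> h cdf; split; [move=> x; case: (h x)|rewrite (derive1P h)].
Qed.

Lemma CkD n f g : Ck n f -> Ck n g -> Ck n (fun x => f x + g x).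
Proof.
elim: n f g => [//|n IH] f g cf cg.
apply: (@CkS _ _ (fun x => derive1 f x + derive1 g x)) => [x|].
  exact: (is_deriveD (Ck_is_derive x cf) (Ck_is_derive x cg)).
by case: cf cg => [_ cf] [_ cg]; exact: IH.
Qed.

Lemma CkM n f g : Ck n f -> Ck n g -> Ck n (fun x => f x * g x).
Proof.
elim: n f g => [//|n IH] f g cf cg.
apply: (@CkS _ _ (fun x => f x * derive1 g x + g x * derive1 f x)) => [x|].
  exact: (is_deriveM (Ck_is_derive x cf) (Ck_is_derive x cg)).
by apply: CkD; apply: IH; (try exact: CkW); [case: cg|case: cf].
Qed.

Lemma Ck_cst n c : Ck n (fun=> c).
Proof.
elim: n c => [//|n IH] c; exact: (@CkS _ _ (fun=> 0)).
Qed.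

Lemma CkV n f : (forall x, f x != 0) -> Ck n f -> Ck n (fun x => (f x)^-1).
Proof.
move=> f0; elim: n => [//|n IH] cf.
apply: (@CkS _ _ (fun x => -1 * ((f x)^-1 * (f x)^-1) * derive1 f x)) => [x|].
  apply: (is_derive_eq (is_deriveV (f0 x) (Ck_is_derive x cf))).
  by rewrite /GRing.scale/= expr2 invfM mulN1r.
apply: CkM; last by case: cf.
apply: (@CkM n (fun=> -1)); first exact: Ck_cst.
by apply: CkM; apply: IH; exact: CkW.
Qed.

Lemma Ck_id n : Ck n (fun x => x).
Proof.
case: n => [//|n]; apply: (@CkS _ _ (fun=> 1)); exact: Ck_cst.
Qed.

Lemma is_derive_affine f c d x (df : R) : is_derive (c + d * x) 1 f df ->
  is_derive x 1 (fun x : R => f (c + d * x)) (d * df).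
Proof.
move=> h.
have h2 : is_derive x (1:R) (fun x : R => c + d * x) d.
  by apply: is_derive_eq; rewrite /GRing.scale/=; ring.
have := @is_derive1_comp _ f (fun x : R => c + d * x) x _ _ h h2.
by rewrite mulrC.
Qed.

Lemma Ck_affine n f c d : Ck n f -> Ck n (fun x => f (c + d * x)).
Proof.
elim: n f => [//|n IH] f cf.
apply: (@CkS _ _ (fun x => d * derive1 f (c + d * x))) => [x|].
  by apply: is_derive_affine; exact: Ck_is_derive cf.
by apply: (@CkM n (fun=> d)); [exact: Ck_cst|apply: IH; case: cf].
Qed.

Lemma smoothD f g : smooth f -> smooth g -> smooth (fun x => f x + g x).
Proof. by move=> /smoothP sf /smoothP sg; apply/smoothP => n; exact: CkD. Qed.

Lemma smoothM f g : smooth f -> smooth g -> smooth (fun x => f x * g x).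
Proof. by move=> /smoothP sf /smoothP sg; apply/smoothP => n; exact: CkM. Qed.

Lemma smooth_cst c : smooth (fun=> c).
Proof. by apply/smoothP => n; exact: Ck_cst. Qed.

Lemma smooth_affine f c d : smooth f -> smooth (fun x => f (c + d * x)).
Proof. by move=> /smoothP sf; apply/smoothP => n; exact: Ck_affine. Qed.

(* The derivatives of exp(-1/x) are linear combinations of the functions
   x^(-n) exp(-1/x); this family is what makes its smoothness an induction. *)
Definition flat n : R -> R := fun x => if 0 < x then x^-1 ^+ n * expR (- x^-1) else 0.

(** From exp(y) >= y^(n+2) / (n+2)! at y = 1/x. A quadratic bound is just enough for the derivative
    at 0 to exist and vanish. *)
Lemma flat_le n x : `|flat n x| <= (n.+2)`!%:R * x ^+ 2.
Proof.
rewrite /flat; case: ifPn => [x0|_]; last first.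
  by rewrite normr0 mulr_ge0// sqr_ge0.
have xV : 0 < x^-1 by rewrite invr_gt0.
rewrite ger0_norm; last by rewrite mulr_ge0// ?expR_ge0// exprn_ge0// ltW.
rewrite expRN ler_pdivrMr ?expR_gt0//.
have := expR_ge1Dxn n.+1 (ltW xV).
have f0 : 0 < (n.+2)`!%:R :> R by rewrite ltr0n fact_gt0.
move=> h; have {h} : x^-1 ^+ n.+2 <= (n.+2)`!%:R * expR x^-1.
  rewrite mulrC -ler_pdivrMr//; apply: le_trans h; by rewrite lerDr.
move=> h.
have -> : x^-1 ^+ n = x ^+ 2 * x^-1 ^+ n.+2.
  by rewrite -(addn2 n) exprD mulrCA -exprMn mulfV ?gt_eqF// expr1n mulr1.
by rewrite [leRHS]mulrAC [leRHS]mulrC ler_pM2l ?exprn_gt0.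
Qed.

Lemma flat0 n x : x <= 0 -> flat n x = 0.
Proof. by rewrite /flat ltNge => ->. Qed.

Lemma flat_gt0 x : 0 < x -> 0 < flat 0 x.
Proof. by move=> x0; rewrite /flat x0 expr0 mul1r expR_gt0. Qed.

Lemma flat_ge0 x : 0 <= flat 0 x.
Proof. by have [x0|x0] := ltP 0 x; [rewrite ltW// flat_gt0|rewrite flat0]. Qed.

Lemma is_derive0_quadratic f C : (forall x, `|f x| <= C * x ^+ 2) ->
  is_derive (0 : R) 1 f 0.
Proof.
move=> fC.
have f0 : f 0 = 0.
  by apply/normr0_eq0/eqP; rewrite eq_le normr_ge0 andbT (le_trans (fC 0))// expr0n/= mulr0.
have C0 : 0 <= C.
  by have := fC 1; rewrite expr1n mulr1; apply: le_trans.
have cv : h^-1 *: (f (h *: (1 : R) + 0) - f 0) @[h --> (0 : R)^'] --> (0 : R).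
  apply/cvgr0Pnorm_le => e e0; near=> h.
  have h0 : 0 < `|h| by rewrite normr_gt0; near: h; exact: nbhs_dnbhs_neq.
  rewrite f0 subr0 addr0 /GRing.scale/= mulr1 normrM normfV ler_pdivrMl//.
  apply: le_trans (fC h) _.
  have -> : C * h ^+ 2 = `|h| * (C * `|h|) by rewrite -real_normK ?num_real// expr2 mulrCA.
  (* [C] may be 0, and the threshold for h comes from a division; hence [C + 1]. *)
  rewrite ler_pM2l//; apply: (@le_trans _ _ ((C + 1) * `|h|)).
    by rewrite ler_wpM2r// lerDl.
  rewrite mulrC -ler_pdivlMr; last by rewrite ltr_wpDl.
  near: h; apply: dnbhs0_le; rewrite divr_gt0// ltr_wpDl//.
apply: DeriveDef; first by apply/cvg_ex; exists 0.
exact: cvg_lim cv.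
Unshelve. all: by end_near. Qed.

Lemma is_derive_flat n x :
  is_derive x 1 (flat n) (flat n.+2 x + (- n%:R) * flat n.+1 x).
Proof.
have [x0|x0|->] := ltgtP x 0.
- rewrite !flat0 ?(ltW x0)// mulr0 addr0.
  have h : {near x, cst 0 =1 flat n}.
    near=> y; rewrite flat0//; apply: ltW; near: y; exact: lt_nbhsl.
  exact: (near_eq_is_derive h).
- have h : {near x, (fun x => x^-1 ^+ n * expR (- x^-1)) =1 flat n}.
    near=> y; rewrite /flat; case: ifPn => //.
    move/negP; case; near: y; exact: lt_nbhsr.
  apply: (near_eq_is_derive h).
  have xn0 : x != 0 by rewrite gt_eqF.
  have hV : is_derive x (1 : R) (fun y : R => y^-1) (- x ^- 2).
    apply: (is_derive_eq (is_deriveV xn0 (is_derive_id x 1))).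
    by rewrite /GRing.scale/= mulr1.
  have hE : is_derive x (1 : R) (fun y : R => expR (- y^-1)) (x ^- 2 * expR (- x^-1)).
    have := @is_derive1_comp _ expR (fun y : R => - y^-1) x _ _
      (is_derive_expR _) (is_deriveN hV).
    by rewrite opprK mulrC.
  have hX : is_derive x (1 : R) (fun y : R => y^-1 ^+ n) (- (n%:R * x^-1 ^+ n.+1)).
    have -> : (fun y : R => y^-1 ^+ n) = (fun y : R => y^-1) ^+ n.
      by apply/funext => y; rewrite exprfctE.
    apply: (is_derive_eq (is_deriveX n hV)).
    case: n {h} => [|m]; rewrite /GRing.scale/= ?mul0r ?oppr0// -exprVn !exprS expr0; ring.
  apply: (is_derive_eq (is_deriveM hX hE)).
  rewrite /flat x0 /GRing.scale/= -exprVn !exprS expr0; ring.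
- rewrite !flat0// mulr0 addr0.
  exact: (is_derive0_quadratic (flat_le n)).
Unshelve. all: by end_near. Qed.

Lemma Ck_flat k n : Ck k (flat n).
Proof.
elim: k n => [//|k IH] n.
apply: (@CkS _ _ (fun x => flat n.+2 x + (- n%:R) * flat n.+1 x)) => [x|].
  exact: is_derive_flat.
apply: CkD; first exact: IH.
by apply: (@CkM _ (fun=> - n%:R)); [exact: Ck_cst|exact: IH].
Qed.

(** The terms vanish for x <= 0 and for x >= 1 respectively, never together, so [flat 0 x / den x]
    is a smooth step from 0 to 1 across [[0, 1]]. *)
Let den (x : R) : R := flat 0 x + flat 0 (1 + (-1) * x).

Let den_gt0 x : 0 < den x.
Proof.
rewrite /den; have [x0|x0] := ltP 0 x.
  by rewrite ltr_pwDl// ?flat_gt0// flat_ge0.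
by rewrite ltr_wpDl ?flat_ge0// flat_gt0//; lra.
Qed.

(* A smooth version of the positive part [x |-> max x 0]. *)
Definition soft (x : R) : R := x * (flat 0 x / den x).

Let smooth_quotient : smooth (fun x => flat 0 x / den x).
Proof.
apply/smoothP => n; apply: CkM; first exact: Ck_flat.
apply: CkV; first by move=> x; rewrite gt_eqF// den_gt0.
apply: (@CkD _ (flat 0)); first exact: Ck_flat.
by apply: Ck_affine; exact: Ck_flat.
Qed.

Lemma smooth_soft : smooth soft.
Proof.
apply: (@smoothM (fun x => x)); last exact: smooth_quotient.
by apply/smoothP => n; exact: Ck_id.
Qed.

Lemma soft0 x : x <= 0 -> soft x = 0.
Proof. by move=> x0; rewrite /soft flat0// mul0r mulr0. Qed.

Lemma soft1 x : 1 <= x -> soft x = x.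
Proof.
move=> x1; rewrite /soft /den [flat 0 (1 + _)]flat0; last by lra.
by rewrite addr0 mulfV ?mulr1// gt_eqF// flat_gt0//; lra.
Qed.

Lemma derive_soft0 x : x <= 0 -> derive1 soft x = 0.
Proof.
rewrite le_eqVlt derive1E => /predU1P[->|x0].
  (* At 0 the function is constant on one side only; the product rule leaves the value of the
     quotient, which is 0 there. *)
  case: (is_deriveM (is_derive_id (0 : R) (1 : R)) (smooth_is_derive 0 smooth_quotient)) => _ ->.
  by rewrite scale0r add0r flat0// mul0r scale0r.
have h : {near x, cst 0 =1 soft}.
  near=> y; rewrite soft0//; apply: ltW; near: y; exact: lt_nbhsl.
by case: (near_eq_is_derive h (is_derive_cst 0 x 1)).
Unshelve. all: by end_near. Qed.

Lemma derive_soft1 x : 1 < x -> (derive1 soft) x = 1.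
Proof.
move=> x0; rewrite derive1E.
have h : {near x, (@idfun R) =1 soft}.
  near=> y; rewrite soft1//; apply: ltW; near: y; exact: lt_nbhsr.
by case: (near_eq_is_derive h (is_derive_id x 1)).
Unshelve. all: by end_near. Qed.

(** The derivative is constant outside [[0, 1]] and continuous on it. Its bound serves all the ramps
    of given ends at once, whatever [n]: this is the domination in [cvg_integral_ramp]. *)
Lemma derive_soft_bounded : exists2 M : R, 0 <= M & forall x, `|(derive1 soft) x| <= M.
Proof.
have cd : continuous ((derive1 soft)).
  move=> x; apply: differentiable_continuous; apply/derivable1_diffP.
  by apply: smooth_derivable; apply: smooth_derive1; exact: smooth_soft.
have cc : {within `[(0:R), 1], continuous (fun x => `|(derive1 soft) x|)}.
  apply: continuous_subspaceT => x; apply: continuous_comp; first exact: cd.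
  exact: norm_continuous.
have [c _ cM] := EVT_max ler01 cc.
exists (Num.max `|(derive1 soft) c| 1) => [|x]; first by rewrite le_max ler01 orbT.
have [x0|x0] := ltP x 0; first by rewrite (derive_soft0 (ltW x0)) normr0 le_max ler01 orbT.
have [x1|x1] := ltP 1 x; first by rewrite derive_soft1// normr1 le_max lexx orbT.
by rewrite le_max cM// in_itv/= x0.
Qed.

End smooth_functions.

(** * The du Bois-Reymond lemma and vanishing of integrals over subintervals *)

Section dubois_reymond.
Context {R : realType}.
Local Notation mu := (@lebesgue_measure R).
Implicit Types (f g phi : R -> R) (a b c d x : R).

(* A smooth approximation, as n tends to infinity, of the piecewise linear function
   rising from 0 at c to 1 at d: its derivative tends to the normalised indicator
   function of ]c, d]. *)
Definition ramp c d n x : R :=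
  (n.+1%:R * (d - c))^-1 * (soft (n.+1%:R * (x - c)) - soft (n.+1%:R * (x - d))).

Lemma smooth_ramp c d n : smooth (ramp c d n).
Proof.
apply: (@smoothM _ (fun=> (n.+1%:R * (d - c))^-1)); first exact: smooth_cst.
have h e : smooth (fun x => soft (n.+1%:R * (x - e))).
  have -> : (fun x => soft (n.+1%:R * (x - e))) =
     (fun x => soft (- (n.+1%:R * e) + n.+1%:R * x)).
    by apply/funext => x; rewrite mulrBr addrC.
  apply: smooth_affine; exact: smooth_soft.
have -> : (fun x => soft (n.+1%:R * (x - c)) - soft (n.+1%:R * (x - d))) =
  (fun x => soft (n.+1%:R * (x - c)) + (-1) * soft (n.+1%:R * (x - d))).
  by apply/funext => x; rewrite mulN1r.
apply: smoothD => //; apply: (@smoothM _ (fun=> -1)) => //; exact: smooth_cst.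
Qed.

Lemma ramp0 c d n x : c <= d -> x <= c -> ramp c d n x = 0.
Proof.
move=> cd xc; rewrite /ramp !soft0 ?subrr ?mulr0//.
  by rewrite pmulr_rle0// subr_le0 (le_trans xc).
by rewrite pmulr_rle0// subr_le0.
Qed.

Lemma ramp1 c d n x : c < d -> d + n.+1%:R^-1 <= x -> ramp c d n x = 1.
Proof.
move=> cd dx.
have n0 : 0 < n.+1%:R :> R by [].
have h e : e <= d -> 1 <= n.+1%:R * (x - e).
  move=> ed; rewrite mulrC -ler_pdivrMr// mul1r lerBrDr addrC (le_trans _ dx)// lerD2r//.
rewrite /ramp !soft1 ?h ?(ltW cd)// -mulrBr.
have -> : x - c - (x - d) = d - c by ring.
by rewrite mulVf// mulf_neq0// ?gt_eqF// subr_gt0.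
Qed.

Lemma derive_ramp c d n : derive1 (ramp c d n) =
  (fun x => (d - c)^-1 * (derive1 soft (n.+1%:R * (x - c)) - derive1 soft (n.+1%:R * (x - d)))).
Proof.
apply: derive1P => x.
have h e : is_derive x (1 : R) (fun x : R => soft (n.+1%:R * (x - e)))
    (n.+1%:R * derive1 soft (n.+1%:R * (x - e))).
  have -> : (fun x => soft (n.+1%:R * (x - e))) =
     (fun x => soft (- (n.+1%:R * e) + n.+1%:R * x)).
    by apply/funext => y; rewrite mulrBr addrC.
  apply: is_derive_affine.
  have -> : - (n.+1%:R * e) + n.+1%:R * x = n.+1%:R * (x - e) by rewrite mulrBr addrC.
  by apply: smooth_is_derive; exact: smooth_soft.
have := is_deriveZ (n.+1%:R * (d - c))^-1 (is_deriveB (h c) (h d)).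
move=> h2; apply: (is_derive_eq h2).
by rewrite /GRing.scale/= -mulrBr invfM mulrA [_^-1 / _]mulrC mulfVK.
Qed.

Lemma compact_support_test a b lo hi phi : smooth phi -> a < lo -> hi < b ->
  (forall x, ~~ (lo <= x <= hi) -> phi x = 0) -> test_function `]a, b[ phi.
Proof.
move=> sphi alo hib phi0.
have sub : closure [set x | phi x != 0] `<=` `[lo, hi].
  have /closure_id -> : closed (`[lo, hi]%classic : set R) by exact: itv_closed.
  apply: closureS => x /=; rewrite in_itv/=; apply: contraNT => xlh.
  by rewrite phi0.
split => //.
- apply: (subclosed_compact _ _ sub); first exact: closed_closure.
  exact: segment_compact.
- apply: (subset_trans sub) => x /=; rewrite !in_itv/= => /andP[lx xh].
  by rewrite (lt_le_trans alo lx) (le_lt_trans xh hib).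
Qed.

Lemma cvg_soft_step (y : R) : derive1 soft (n.+1%:R * y) @[n --> \oo] --> ((0 < y)%R%:R : R).
Proof.
have [y0|y0] := ltP 0 y; last first.
  have -> : (fun n => derive1 soft (n.+1%:R * y)) = cst 0.
    by apply/funext => n; rewrite derive_soft0// pmulr_rle0.
  exact: cvg_cst.
apply: cvg_near_cst; near=> n.
apply/eqP; rewrite derive_soft1//.
rewrite -ltr_pdivrMr// div1r.
apply: lt_le_trans (truncnS_gt _) _.
rewrite ler_nat ltnS; near: n; exact: nbhs_infty_ge.
Unshelve. all: by end_near. Qed.

Lemma cvg_integral_ramp a b c d g : a < c -> c < d -> d < b ->
  mu.-integrable `]a, b[ (EFin \o g) ->
  \int[mu]_(x in `]a, b[) (g x * derive1 (ramp c d n) x) @[n --> \oo] -->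
  (d - c)^-1 * \int[mu]_(x in `]c, d[) g x.
Proof.
move=> ac cd db ig.
have dc0 : 0 < d - c by rewrite subr_gt0.
have [M M0 boundM] := @derive_soft_bounded R.
have mg : measurable_fun `]a, b[ g by apply/measurable_EFinP; exact: measurable_int ig.
have mder n : measurable_fun `]a, b[ (derive1 (ramp c d n)).
  apply: measurable_funTS; apply: continuous_measurable_fun => x.
  apply: differentiable_continuous; apply/derivable1_diffP.
  by apply: smooth_derivable; apply: smooth_derive1; exact: smooth_ramp.
pose h (x : R) := (d - c)^-1 * ((0 < x - c)%R%:R - (0 < x - d)%R%:R).
have hE (x : R) : h x = (d - c)^-1 * \1_(`]c, d]%classic) x.
  rewrite /h indicE mem_setE in_itv/= !subr_gt0.
  have [xd|dx] := leP x d.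
    by rewrite andbT subr0.
  by rewrite andbF (lt_trans cd dx) subrr.
have [] := @dominated_convergence _ _ _ mu `]a, b[%classic (measurable_itv _)
   (fun n x => (g x * derive1 (ramp c d n) x)%:E)
   (fun x => (g x * h x)%:E)
   (fun x => ((d - c)^-1 * (M + M))%:E * `|(g x)%:E|)%E.
- by move=> n; apply/measurable_EFinP; apply: measurable_funM; [exact: mg|exact: mder].
- apply/measurable_EFinP; apply: measurable_funM => //.
  rewrite (_ : h = (fun x => (d - c)^-1 * \1_(`]c, d]%classic) x)); last exact/funext.
  by apply: measurable_funM => //; exact: measurable_indic.
- apply: aeW => x xab; apply: cvg_EFin; first exact: nearW.
  rewrite /comp/=; apply: cvgM; first exact: cvg_cst.
  under eq_fun do rewrite derive_ramp.
  apply: cvgM; first exact: cvg_cst.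
  by apply: cvgB; exact: cvg_soft_step.
- apply: integrableZl => //; exact: integrable_abse.
- apply: aeW => x n xab.
  rewrite abse_EFin normrM EFinM muleC lee_wpmul2r// lee_fin derive_ramp.
  rewrite normrM gtr0_norm ?invr_gt0// ler_pM2l ?invr_gt0//.
  by apply: le_trans (ler_normB _ _) _; rewrite lerD.
move=> ih _ cv.
rewrite /Rintegral.
have -> : (d - c)^-1 * fine (\int[mu]_(x in `]c, d[) (g x)%:E) =
   fine (\int[mu]_(x in `]a, b[) (g x * h x)%:E).
  have icd : mu.-integrable `]c, d[ (EFin \o g).
    by apply: integrableS ig => //; apply: subset_itv; rewrite bnd_simp ltW.
  rewrite -[X in _ * X]/(Rintegral mu _ _) -RintegralZl//.
  rewrite Rintegral_itv_bndo_bndc; last first.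
    have := @integrableZl _ _ _ mu _ (measurable_itv `]c, d[) (d - c)^-1 _ icd.
    by apply: eq_integrable => // x _; rewrite /= EFinM.
  rewrite /Rintegral; congr fine.
  rewrite integral_mkcond [RHS]integral_mkcond.
  apply: eq_integral => x _; rewrite !patchE hE indicE !mem_setE !in_itv/=.
  have [cx|] := ltP c x; last by rewrite /= !mulr0 if_same.
  have [xd|] := leP x d; last by rewrite /= !mulr0 if_same.
  by rewrite (lt_trans ac cx) (le_lt_trans xd db)/= mulr1 mulrC.
apply: fine_cvg; rewrite fineK//.
exact: integrable_fin_num.
Qed.

(** A single ramp equals 1 near [b] and is no test function, but the difference of two ramps is.
    Testing against it shows in the limit that the means of [g] over two intervals agree; [K] is the
    mean over a reference interval, the middle third. *)
Lemma dubois_reymond_mean a b g : a < b ->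
  mu.-integrable `]a, b[ (EFin \o g) ->
  (forall phi, test_function `]a, b[ phi ->
     \int[mu]_(x in `]a, b[) (g x * derive1 phi x) = 0) ->
  exists K, forall c d, a < c -> c < d -> d < b ->
    \int[mu]_(x in `]c, d[) g x = K * (d - c).
Proof.
move=> ab ig g0.
pose c0 := a + (b - a) / 3; pose d0 := a + (b - a) * 2 / 3.
have ac0 : a < c0 by rewrite /c0; lra.
have cd0 : c0 < d0 by rewrite /c0 /d0; lra.
have db0 : d0 < b by rewrite /d0; lra.
exists ((d0 - c0)^-1 * \int[mu]_(x in `]c0, d0[) g x) => c d ac cd db.
have dc0 : 0 < d - c by rewrite subr_gt0.
suff : (d - c)^-1 * \int[mu]_(x in `]c, d[) g x =
       (d0 - c0)^-1 * \int[mu]_(x in `]c0, d0[) g x.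
  by move=> <-; rewrite mulrC mulVKf// gt_eqF.
have cv := cvg_integral_ramp ac cd db ig.
have cv0 := cvg_integral_ramp ac0 cd0 db0 ig.
set l := (X in X = _); set l0 := (X in _ = X).
pose u n := \int[mu]_(x in `]a, b[) (g x * derive1 (ramp c d n) x).
suff cv0' : u @ \oo --> l0.
  exact: (@cvg_unique _ (@Rhausdorff R) (u @ \oo) _ l l0 cv cv0').
apply: cvg_trans cv0; apply: near_eq_cvg.
near=> n.
pose D := Num.max d d0.
have Db : D < b by rewrite gt_max db db0.
(* Both ramps are constant from [D + 1/(n+1)] on, so for large [n] their difference is supported
   inside []a, b[]. *)
have Dn : D + n.+1%:R^-1 < b.
  rewrite -ltrBrDl invf_plt ?posrE ?subr_gt0//.
  apply: lt_le_trans (truncnS_gt _) _.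
  by rewrite ler_nat ltnS; near: n; exact: nbhs_infty_ge.
have sr := smooth_ramp.
pose phi x := ramp c0 d0 n x + (-1) * ramp c d n x.
have sphi : smooth phi.
  by apply: smoothD => //; apply: (@smoothM _ (fun=> -1)) => //; exact: smooth_cst.
have tphi : test_function `]a, b[ phi.
  apply: (@compact_support_test _ _ (Num.min c c0) (D + n.+1%:R^-1)) => //.
    by rewrite lt_min ac ac0.
  move=> x; rewrite negb_and -!ltNge /phi => /orP[|xD].
    by rewrite lt_min => /andP[xc xc0]; rewrite !ramp0 ?(ltW xc0) ?(ltW xc) ?(ltW cd) ?(ltW cd0)// mulr0 addr0.
  rewrite !ramp1 ?mulr1 ?subrr//.
    by apply: le_trans (ltW xD); rewrite lerD2r le_max lexx.
  by apply: le_trans (ltW xD); rewrite lerD2r le_max lexx orbT.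
have dphi x : derive1 phi x = derive1 (ramp c0 d0 n) x - derive1 (ramp c d n) x.
  suff -> : derive1 phi = (fun x => derive1 (ramp c0 d0 n) x - derive1 (ramp c d n) x) by [].
  apply: derive1P => y.
  have := is_deriveB (smooth_is_derive y (sr c0 d0 n)) (smooth_is_derive y (sr c d n)).
  congr (is_derive _ _ _ _); apply/funext => z; rewrite /phi mulN1r//.
have igr (e t : R) : e < t -> mu.-integrable `]a, b[ (EFin \o (fun x => g x * derive1 (ramp e t n) x)).
  move=> et; have [M M0 boundM] := @derive_soft_bounded R.
  have te0 : 0 < t - e by rewrite subr_gt0.
  apply: (@le_integrable _ _ _ mu _ (measurable_itv _) _ (fun x => ((t - e)^-1 * (M + M))%:E * `|(g x)%:E|)%E).
  - apply/measurable_EFinP; apply: measurable_funM.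
      by apply/measurable_EFinP; exact: measurable_int ig.
    apply: measurable_funTS; apply: continuous_measurable_fun => x.
    apply: differentiable_continuous; apply/derivable1_diffP.
    by apply: smooth_derivable; apply: smooth_derive1; exact: smooth_ramp.
  - move=> x _; rewrite /= derive_ramp lee_fin normrM mulrC [leRHS]ger0_norm; last first.
      by apply: mulr_ge0 => //; apply: mulr_ge0; [rewrite invr_ge0 ltW|rewrite addr_ge0].
    rewrite ler_wpM2r// normrM gtr0_norm ?invr_gt0// ler_pM2l ?invr_gt0//.
    by apply: le_trans (ler_normB _ _) _; rewrite lerD.
  - apply: integrableZl => //; exact: integrable_abse.
have := g0 _ tphi.
under eq_Rintegral do rewrite dphi mulrBr.
rewrite (@RintegralB _ _ _ mu `]a, b[%classic _ _ (measurable_itv _) (igr _ _ cd0) (igr _ _ cd)).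
by move/eqP; rewrite subr_eq0 => /eqP.
Unshelve. all: by end_near. Qed.

(** The primitive of the zero extension is constant on []a, b[], and by Lebesgue differentiation its
    derivative is [f] almost everywhere. *)
Lemma ae_eq0_itv a b f : mu.-integrable `]a, b[ (EFin \o f) ->
  (forall c d, a < c -> c < d -> d < b -> \int[mu]_(x in `]c, d[) f x = 0) ->
  {ae mu, forall x, a < x < b -> f x = 0}.
Proof.
move=> intf f0.
pose g := f \_ `]a, b[.
have ig : mu.-integrable setT (EFin \o g).
  rewrite /g -restrict_EFin.
  by rewrite -integrable_mkcond.
have lg : locally_integrable [set: R] g.
  by apply: open_integrable_locally => //; exact: openT.
have igy y : mu.-integrable `]-oo, y] (EFin \o g) by exact: integrableS ig.
have := FTC1Ny igy lg.
move=> /=; apply: filterS; first exact: (ae_filter_ringOfSetsType mu).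
move=> x [dF F'] /andP[ax xb].
have -> : f x = g x by rewrite /g patchE mem_set//= in_itv/= ax xb.
rewrite -F'.
pose F y := \int[mu]_(t in `]-oo, y]) g t.
have h : {near x, cst (F x) =1 F}.
  near=> y.
  have ay : a < y by near: y; exact: lt_nbhsr.
  have yb : y < b by near: y; exact: lt_nbhsl.
  have key u w : a < u -> u <= w -> w < b -> F w = F u.
    move=> au uw wb; apply/eqP; rewrite -subr_eq0; apply/eqP.
    rewrite /F Rintegral_itvB//.
    rewrite -Rintegral_itv_bndo_bndc; last exact: integrableS ig.
    move: uw; rewrite le_eqVlt => /predU1P[<-|uw].
      by rewrite set_itvoo0 Rintegral_set0.
    rewrite -[RHS](f0 u w)//; apply: eq_Rintegral => t.
    rewrite inE/= in_itv/= => /andP[ut tw].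
    by rewrite /g patchE mem_set//= in_itv/= (lt_trans au ut) (lt_trans tw wb).
  have [yx|xy] := leP y x; first exact: key.
  by rewrite /cst (key x y)// ltW.
by rewrite derive1E; case: (near_eq_is_derive h (is_derive_cst (F x) x 1)).
Unshelve. all: by end_near. Qed.

End dubois_reymond.

(** * Fractional derivatives of test functions *)

Section fractional_derivative_of_test_functions.
Context {R : realType}.
Local Notation mu := (@lebesgue_measure R).
Implicit Types (phi : R -> R) (a b x alpha : R).

Section test_function.
Variables (a b : R) (phi : R -> R).
Hypothesis tphi : test_function `]a, b[ phi.

Lemma test_smooth : smooth phi.
Proof. by case: tphi. Qed.

(** The closed support lies in the open interval, so even at [a] and [b] there is a whole
    neighbourhood of zeros; this carries the vanishing over to the derivative. *)
Lemma test_nearby0 x : ~~ (a < x < b) -> \forall y \near x, phi y = 0.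
Proof.
move=> xab; case: tphi => _ _ sub.
have nx : (~` closure [set x | phi x != 0]) x.
  by move=> /sub/=; rewrite in_itv/=; exact/negP.
have op : open (~` closure [set x | phi x != 0]).
  by rewrite openC; exact: closed_closure.
have := open_nbhs_nbhs (conj op nx); apply: filterS => y /= ny.
apply/eqP/negPn/negP => phiy; apply: ny; exact: subset_closure.
Qed.

Lemma test_eq0 x : ~~ (a < x < b) -> phi x = 0.
Proof. by move=> /test_nearby0/nbhs_singleton. Qed.

Lemma test_derive1_eq0 x : ~~ (a < x < b) -> derive1 phi x = 0.
Proof.
move=> /test_nearby0 h; rewrite derive1E.
have {}h : {near x, cst 0 =1 phi} by apply: filterS h.
by case: (near_eq_is_derive h (is_derive_cst 0 x 1)).
Qed.

Lemma smooth_continuous (f : R -> R) : smooth f -> continuous f.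
Proof.
move=> sf x; apply: differentiable_continuous; apply/derivable1_diffP.
exact: smooth_derivable.
Qed.

Lemma bounded_of_support (f : R -> R) : continuous f ->
  (forall x, ~~ (a < x < b) -> f x = 0) -> exists2 M, 0 <= M & forall x, `|f x| <= M.
Proof.
move=> cf f0; have [ab|ba] := leP a b; last first.
  exists 0 => // x; rewrite f0 ?normr0//; apply/negP => /andP[ax xb].
  by have := lt_trans (lt_trans ax xb) ba; rewrite ltxx.
have cc : {within `[a, b], continuous (fun x => `|f x|)}.
  apply: continuous_subspaceT => x; apply: continuous_comp; first exact: cf.
  exact: norm_continuous.
have [c _ cM] := EVT_max ab cc.
exists `|f c| => // x.
have [/andP[ax xb]|xab] := boolP (a < x < b); last by rewrite f0// normr0.
by rewrite cM// in_itv/= !ltW.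
Qed.

Lemma test_bounded : exists2 M, 0 <= M & forall x, `|phi x| <= M.
Proof.
apply: bounded_of_support test_eq0; apply: smooth_continuous; exact: test_smooth.
Qed.

Lemma test_derive1_bounded : exists2 M, 0 <= M & forall x, `|derive1 phi x| <= M.
Proof.
apply: bounded_of_support test_derive1_eq0; apply: smooth_continuous.
by apply: smooth_derive1; exact: test_smooth.
Qed.

Lemma measurable_test : measurable_fun [set: R] phi.
Proof.
apply: continuous_measurable_fun; apply: smooth_continuous; exact: test_smooth.
Qed.

Lemma measurable_test_derive1 : measurable_fun [set: R] (derive1 phi).
Proof.
apply: continuous_measurable_fun; apply: smooth_continuous.
by apply: smooth_derive1; exact: test_smooth.
Qed.

Lemma integrable_bounded_kernel (f k : R -> R) M : measurable_fun [set: R] f ->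
  mu.-integrable setT (EFin \o k) -> (forall x, `|f x| <= M) ->
  mu.-integrable setT (EFin \o (fun x => f x * k x)).
Proof.
move=> mf ik fM.
have M0 : 0 <= M by apply: le_trans (fM 0).
apply: (@le_integrable _ _ _ mu _ measurableT _ (fun x => M%:E * (k x)%:E)%E).
- apply/measurable_EFinP; apply: measurable_funM => //.
  by apply/measurable_EFinP; exact: measurable_int ik.
- move=> x _; rewrite /= lee_fin !normrM ler_wpM2r//.
  by rewrite (ger0_norm M0).
- exact: integrableZl.
Qed.

(** [power_kernel 1 L] is the indicator function of []0, L[], so the integral of phi' runs from [y]
    to [y + (b - a)], a point beyond [b] where phi vanishes. *)
Lemma test_integral_derive1 y : a < y < b ->
  \int[mu]_t (derive1 phi t * power_kernel 1 (b - a) (t - y)) = - phi y.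
Proof.
move=> /andP[ay yb].
have yL : y < y + (b - a) by lra.
have sphi := test_smooth.
transitivity (\int[mu]_(t in `]y, (y + (b - a))[) derive1 phi t).
  rewrite [RHS]Rintegral_mkcond; apply: eq_Rintegral => t _.
  rewrite patchE mem_setE in_itv/= -[y < t]subr_gt0 -[t < _]subr_lt0.
  have -> : t - (y + (b - a)) = t - y - (b - a) by ring.
  rewrite subr_lt0; case: ifPn => [h|h]; last by rewrite power_kernel0 ?mulr0.
  by rewrite power_kernelE// subrr powRr0 mulr1.
have cphi := smooth_continuous sphi.
have cdphi := smooth_continuous (smooth_derive1 sphi).
rewrite /Rintegral -(@integral_itv_bndoo _ _ _ _ true false); last first.
  by apply/measurable_EFinP; apply: measurable_funTS; exact: measurable_test_derive1.
rewrite (@continuous_FTC2 _ _ phi)//.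
- rewrite (test_eq0 (x := y + (b - a))); last first.
    by rewrite negb_and -!leNgt; apply/orP; right; lra.
  by rewrite -EFinB sub0r.
- exact: continuous_subspaceT.
- split => [x _||]; first exact: smooth_derivable.
  + exact: cvg_at_right_filter (cphi y).
  + exact: cvg_at_left_filter (cphi _).
Qed.

Section derivative.
Variables (alpha : R).
Hypothesis alpha1 : alpha < 1.

(** The substitution s = y - t moves the parameter from the singular kernel into phi, where it can
    be differentiated under the integral sign. *)
Lemma test_tail_integralE t : \int[mu]_(y in `]t, +oo[) (phi y / (y - t) `^ alpha) =
  \int[mu]_s (phi (s + t) * half_power (1 - alpha) s).
Proof.
rewrite Rintegral_mkcond /Rintegral; congr fine.
have mg : measurable_fun [set: R] (fun s => (phi (s + t) * half_power (1 - alpha) s)%:E).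
  apply/measurable_EFinP; apply: measurable_funM; last exact: measurable_half_power.
  by apply: (measurableT_comp measurable_test); exact: measurable_funD.
rewrite -(integral_translate t mg).
apply: eq_integral => y _; rewrite patchE mem_setE in_itv/= andbT subrK; congr EFin.
have [ty|yt] := ltP t y; last by rewrite half_power0 ?mulr0// subr_le0.
by rewrite half_powerE ?subr_gt0// -powRN; congr (_ * _ `^ _); ring.
Qed.

Lemma is_derive_test_tail x :
  is_derive x 1 (fun t : R => \int[mu]_(y in `]t, +oo[) (phi y / (y - t) `^ alpha))
    (\int[mu]_y (derive1 phi y * half_power (1 - alpha) (y - x))).
Proof.
have a1 : 0 < 1 - alpha by rewrite subr_gt0.
(* If t > x - 1 and s >= b - x + 1 then s + t > b and phi (s + t) = 0. For t near x this truncation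
   is therefore invisible, and it makes the majorant [N * k s] integrable. *)
pose k := power_kernel (1 - alpha) (b - x + 1).
have ik : mu.-integrable setT (EFin \o k) by exact: power_kernel_integrable.
have [M M0 phiM] := test_bounded.
have [N N0 phiN] := test_derive1_bounded.
have sphi := test_smooth.
have cut (f : R -> R) t s : (forall x, ~~ (a < x < b) -> f x = 0) -> x - 1 < t ->
    f (s + t) * half_power (1 - alpha) s = f (s + t) * k s.
  move=> f0 tx; have [s0|s0] := leP s 0.
    by rewrite half_power0// /k power_kernel0// ltNge s0.
  have [sL|Ls] := ltP s (b - x + 1).
    by rewrite half_powerE// /k power_kernelE// s0.
  rewrite f0 ?mul0r// negb_and -!leNgt; apply/orP; right; lra.
have h : {near x, (fun t => \int[mu]_(s in setT) (phi (s + t) * k s)) =1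
    (fun t : R => \int[mu]_(y in `]t, +oo[) (phi y / (y - t) `^ alpha))}.
  near=> t; rewrite test_tail_integralE; apply: eq_Rintegral => s _.
  rewrite cut//; first exact: test_eq0.
  by near: t; apply: lt_nbhsr; rewrite ltrBlDr ltrDl.
apply: (near_eq_is_derive h).
have shift t : measurable_fun [set: R] (fun s => phi (s + t)).
  by apply: (measurableT_comp measurable_test); exact: measurable_funD.
pose f t s := phi (s + t) * k s.
have df t s : is_derive t (1 : R) (f ^~ s) (derive1 phi (s + t) * k s).
  rewrite /f; have := @is_derive_affine _ phi s 1 t (derive1 phi (s + t)).
  rewrite !mul1r => /(_ (smooth_is_derive _ sphi)) d1.
  have := is_deriveZ (k s) d1.
  rewrite /GRing.scale/= [k s * _]mulrC; congr is_derive.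
  by apply/funext => y; rewrite /= mul1r mulrC.
have int_f t : `]x - 1, x + 1[%classic t -> mu.-integrable setT (EFin \o f t).
  by move=> _; apply: (@integrable_bounded_kernel _ _ M).
have derf t s : `]x - 1, x + 1[%classic t -> setT s -> derivable (f ^~ s) t 1.
  by move=> _ _; case: (df t s).
have G0 s : 0 <= N * k s by rewrite mulr_ge0// power_kernel_ge0.
have iG : mu.-integrable setT (EFin \o (fun s => N * k s)).
  by apply: (@integrable_bounded_kernel (fun=> N) _ N) => // y; rewrite ger0_norm.
have dfE t s : partial1of2 f t s = derive1 phi (s + t) * k s.
  by rewrite partial1of2E; case: (df t s).
have Gub t s : `]x - 1, x + 1[%classic t -> setT s -> `|partial1of2 f t s| <= N * k s.
  move=> _ _; rewrite dfE normrM (ger0_norm (power_kernel_ge0 _ _ _)).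
  by rewrite ler_wpM2r// power_kernel_ge0.
have xI : `]x - 1, x + 1[%classic x by rewrite /= in_itv/=; apply/andP; split; lra.
have dF := derivable_under_integral measurableT xI int_f derf G0 iG Gub.
have DF := differentiation_under_integral measurableT xI int_f derf G0 iG Gub.
apply: (DeriveDef dF).
rewrite -derive1E DF.
have mg : measurable_fun [set: R] (fun s => (derive1 phi (s + x) * half_power (1 - alpha) s)%:E).
  apply/measurable_EFinP; apply: measurable_funM; last exact: measurable_half_power.
  by apply: (measurableT_comp measurable_test_derive1); exact: measurable_funD.
rewrite /Rintegral; congr fine.
transitivity (\int[mu]_s (derive1 phi (s + x) * half_power (1 - alpha) s)%:E)%E.
  apply: eq_integral => s _; congr EFin; rewrite dfE cut//; first exact: test_derive1_eq0.
  by rewrite ltrBlDr ltrDl.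
rewrite -(integral_translate x mg).
by apply: eq_integral => s _; rewrite subrK.
Unshelve. all: by end_near. Qed.

Lemma right_fderiv_test x : right_fderiv alpha phi x =
  - (Gamma (1 - alpha))^-1 * \int[mu]_y (derive1 phi y * half_power (1 - alpha) (y - x)).
Proof.
rewrite /right_fderiv derive1E; congr (_ * _).
by case: (is_derive_test_tail x).
Qed.

Lemma right_fderiv_test_kernel x : a < x < b -> right_fderiv alpha phi x =
  - (Gamma (1 - alpha))^-1 *
    \int[mu]_y (derive1 phi y * power_kernel (1 - alpha) (b - a) (y - x)).
Proof.
move=> /andP[ax xb]; rewrite right_fderiv_test; congr (_ * _).
apply: eq_Rintegral => y _.
have [/andP[ay yb]|yab] := boolP (a < y < b); last by rewrite test_derive1_eq0 ?mul0r.
have [yx|xy] := leP y x.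
  by rewrite half_power0 ?subr_le0// power_kernel0// subr_gt0 ltNge yx.
by rewrite half_powerE ?subr_gt0// power_kernelE// subr_gt0 xy/=; lra.
Qed.

End derivative.
End test_function.
End fractional_derivative_of_test_functions.

(** * Products of truncated kernels, and fractional integrals as convolutions *)

Section power_kernel_algebra.
Context {R : realType}.
Local Notation mu := (@lebesgue_measure R).
Implicit Types (a b x y s t : R).

Lemma power_kernel_1 L t : power_kernel 1 L t = (0 < t < L)%R%:R.
Proof.
have [h|h] := boolP (0 < t < L); last by rewrite power_kernel0.
by rewrite power_kernelE// subrr powRr0.
Qed.

Lemma power_kernel_cutl s a b x y t : a <= y < b -> a < x < b ->
  power_kernel s (x - a) (x - t) * power_kernel 1 (b - a) (t - y) =
  power_kernel s (x - y) (x - t).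
Proof.
move=> /andP[ay yb] /andP[ax xb]; rewrite power_kernel_1 !subr_gt0.
have [tx|xt] := ltP t x; last first.
  by rewrite !power_kernel0 ?mul0r// subr_gt0 ltNge xt.
have [yt|ty] := ltP y t; last first.
  by rewrite mulr0 power_kernel0// subr_gt0 tx/= -leNgt; lra.
have -> : t - y < b - a by lra.
rewrite mulr1 !power_kernelE// subr_gt0 tx/=; lra.
Qed.

Lemma power_kernel_cutr s a b x y t : a <= y < b -> a < x < b ->
  power_kernel 1 (x - a) (x - t) * power_kernel s (b - a) (t - y) =
  power_kernel s (x - y) (t - y).
Proof.
move=> /andP[ay yb] /andP[ax xb]; rewrite power_kernel_1 !subr_gt0.
have [yt|ty] := ltP y t; last first.
  by rewrite !power_kernel0 ?mulr0// subr_gt0 ltNge ty.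
have [tx|xt] := ltP t x; last first.
  by rewrite mul0r power_kernel0// subr_gt0 yt/= -leNgt; lra.
have -> : x - t < x - a by lra.
rewrite mul1r !power_kernelE// subr_gt0 yt/=; lra.
Qed.

Lemma power_kernel_le_half s L t : power_kernel s L t <= half_power s t.
Proof.
have [h|h] := boolP (0 < t < L); last by rewrite power_kernel0// half_power_ge0.
by rewrite power_kernelE// half_powerE//; case/andP: h.
Qed.

Lemma power_kernel_cut_beta s a b x y t : a <= y < b -> a < x < b ->
  power_kernel s (x - a) (x - t) * power_kernel (1 - s) (b - a) (t - y) =
  half_power s (x - t) * half_power (1 - s) (t - y).
Proof.
move=> /andP[ay yb] /andP[ax xb].
have [yt|ty] := ltP y t; last first.
  rewrite [X in _ * X = _]power_kernel0; last by rewrite subr_gt0 ltNge ty.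
  by rewrite [X in _ = _ * X]half_power0 ?mulr0// subr_le0.
have [tx|xt] := ltP t x; last first.
  rewrite power_kernel0; last by rewrite subr_gt0 ltNge xt.
  by rewrite half_power0 ?mul0r// subr_le0.
rewrite !power_kernelE ?half_powerE ?subr_gt0 ?tx ?yt//=; lra.
Qed.

Lemma integral_beta_le s x y : 0 < s < 1 ->
  (\int[mu]_t (half_power s (x - t) * half_power (1 - s) (t - y))%:E <=
   (Gamma s * Gamma (1 - s))%:E)%E.
Proof.
move=> s01; have [yx|xy] := ltP y x; first by rewrite beta_kernel.
rewrite integral0_eq.
  rewrite lee_fin mulr_ge0// ltW// Gamma_gt0//.
  by case/andP: s01 => s0 s1; rewrite subr_gt0 s1 ltrBlDr ltrDl.
move=> t _; have [yt|ty] := ltP y t; last first.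
  by rewrite [X in _ * X]half_power0 ?mulr0// subr_le0.
by rewrite half_power0 ?mul0r// subr_le0 (le_trans xy)// ltW.
Qed.

Lemma Rintegral_translate (f : R -> R) c : measurable_fun [set: R] f ->
  \int[mu]_x f (x - c) = \int[mu]_x f x.
Proof.
by move=> mf; rewrite /Rintegral (integral_translate c ((measurable_EFinP _ _).2 mf)).
Qed.

Lemma Rintegral_reflect (f : R -> R) c : measurable_fun [set: R] f ->
  \int[mu]_x f (c - x) = \int[mu]_x f x.
Proof.
by move=> mf; rewrite /Rintegral (integral_reflect c ((measurable_EFinP _ _).2 mf)).
Qed.

Lemma integrable_translate (f : R -> R) c : mu.-integrable setT (EFin \o f) ->
  mu.-integrable setT (EFin \o (fun t => f (t - c))).
Proof.
move=> /integrableP[mf foo]; apply/integrableP; split.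
  by apply/measurable_EFinP; apply: measurable_translate; exact/measurable_EFinP.
have mnf : measurable_fun [set: R] (fun x => `|(EFin \o f) x|%E).
  exact: measurableT_comp.
by rewrite -(integral_translate c mnf) in foo.
Qed.

Lemma left_fintE a b s f x : a < x < b ->
  left_fint a s f x =
  (Gamma s)^-1 * convolution (f \_ `]a, b[) (power_kernel s (b - a)) x.
Proof.
move=> /andP[ax xb]; rewrite /left_fint; congr (_ * _).
rewrite Rintegral_mkcond /convolution; apply: eq_Rintegral => y _.
rewrite !patchE !mem_setE !in_itv/=.
have [ay|ya] := ltP a y; last by rewrite /= mul0r.
have [yx|xy] := ltP y x; last first.
  by rewrite /= power_kernel0 ?mulr0// subr_gt0 ltNge xy.
rewrite (lt_trans yx xb)/= power_kernelE; last by rewrite subr_gt0 yx/=; lra.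
by rewrite -powRN opprB.
Qed.

End power_kernel_algebra.

(** * Endpoint values of continuous representatives *)

Section continuous_representative.
Context {R : realType}.
Local Notation mu := (@lebesgue_measure R).
Implicit Types (a b : R) (f g : R -> R).

Lemma ae_itv_witness a c (P : R -> Prop) : a < c ->
  {ae mu, forall x, P x} -> exists2 x, a < x < c & P x.
Proof.
move=> ac [N [mN N0 subN]]; apply: contrapT => nP.
have sub : `]a, c[ `<=` N.
  move=> x /=; rewrite in_itv/= => xac; apply: subN => /= Px.
  by apply: nP; exists x.
have : (mu `]a, c[ <= mu N)%E by apply: le_measure => //; rewrite inE//.
have -> : mu `]a, c[ = (c - a)%:E.
  by have := @lebesgue_measure_itv R `]a, c[; rewrite /= lte_fin ac.
by rewrite [X in (_ <= X)%E]N0 lee_fin subr_le0 leNgt ac.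
Qed.

(** If the values at [a] differed, continuity would keep f - g nonzero on an interval to the right
    of [a], which has positive measure. Hence the choice made in [cont_rep_value] is unique at
    [a]. *)
Lemma continuous_ae_eq_left a b f g : a < b ->
  {within `[a, b], continuous f} -> {within `[a, b], continuous g} ->
  {ae mu, forall x, a < x < b -> f x = g x} -> f a = g a.
Proof.
move=> ab /(continuous_within_itvP _ ab)[_ cf _] /(continuous_within_itvP _ ab)[_ cg _] fg.
have ch : (f x - g x) @[x --> a^'+] --> f a - g a by exact: cvgB.
apply/eqP; rewrite -subr_eq0; apply/negPn/negP => h0.
have : \forall x \near a^'+, f x - g x != 0.
  exact: (cvgr_neq0 _ ch).
move=> [e /= e0 he].
have ace : a < Num.min b (a + e) by rewrite lt_min ab ltrDl.
have [x /andP[ax]] := ae_itv_witness ace fg.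
rewrite lt_min => /andP[xb xe]; rewrite ax xb => /(_ isT) fgx.
have := he x; rewrite /ball/= ltr_distlC => /(_ _ ax).
rewrite fgx subrr eqxx => h.
by have : false by apply: h; apply/andP; split; lra.
Qed.

Lemma cont_rep_valueE a b f g : a < b ->
  {within `[a, b], continuous g} -> {ae mu, forall x, a < x < b -> f x = g x} ->
  cont_rep_value a b f a = g a.
Proof.
move=> ab cg fg; apply: xget_subset1.
  by exists g; split.
move=> _ _ [g1 [c1 f1 <-]] [g2 [c2 f2 <-]].
apply: (continuous_ae_eq_left ab c1 c2).
move: f1 f2; apply: filterS2; first exact: (ae_filter_ringOfSetsType mu).
move=> x h1 h2 xab.
by rewrite -h1 ?h2//= in_itv.
Qed.

End continuous_representative.

(** * The representation of u by its left weak fractional derivative *)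

Section left_representation.
Context {R : realType}.
Local Notation mu := (@lebesgue_measure R).
Variables (a b alpha : R) (u v : R -> R).
Hypothesis ab : a < b.
Hypothesis alpha01 : 0 < alpha < 1.
Hypothesis iu : mu.-integrable `]a, b[ (EFin \o u).
Hypothesis iv : mu.-integrable `]a, b[ (EFin \o v).
Hypothesis uv : forall phi, test_function `]a, b[ phi ->
  \int[mu]_(x in `]a, b[) (v x * phi x) =
  \int[mu]_(x in `]a, b[) (u x * right_fderiv alpha phi x).

Let a0 : 0 < alpha. Proof. by case/andP: alpha01. Qed.
Let a1 : alpha < 1. Proof. by case/andP: alpha01. Qed.
Let a1' : 0 < 1 - alpha. Proof. by rewrite subr_gt0. Qed.
Let alpha01' : 0 < 1 - alpha < 1.
Proof. by rewrite a1' ltrBlDr ltrDl a0. Qed.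

Let G1 := Gamma (1 - alpha).
Let Ga := Gamma alpha.
Let G1_gt0 : 0 < G1. Proof. exact: Gamma_gt0. Qed.
Let Ga_gt0 : 0 < Ga. Proof. exact: Gamma_gt0. Qed.

Let u0 := u \_ `]a, b[.
Let v0 := v \_ `]a, b[.

Let mitv (i : interval R) : measurable ([set` i] : set (measurableTypeR R)).
Proof. exact: measurable_itv. Qed.

Let iu0 : mu.-integrable setT (EFin \o u0).
Proof. by rewrite /u0 -restrict_EFin -integrable_mkcond. Qed.

Let iv0 : mu.-integrable setT (EFin \o v0).
Proof. by rewrite /v0 -restrict_EFin -integrable_mkcond. Qed.

Let k s := power_kernel s (b - a).
Let mk s : measurable_fun [set: R] (k s). Proof. exact: measurable_power_kernel. Qed.
Let k_ge0 s x : 0 <= k s x. Proof. exact: power_kernel_ge0. Qed.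
Let ik (s : R) : 0 < s -> mu.-integrable setT (EFin \o k s).
Proof. exact: power_kernel_integrable. Qed.

Let bounded_kernel (s : R) (P : R -> R) (M : R) : 0 < s -> measurable_fun [set: R] P ->
  (forall x, `|P x| <= M) -> forall y,
  (\int[mu]_t `|P t * k s (t - y)|%:E <= (M * \int[mu]_t k s t)%:E)%E.
Proof.
move=> s0 mP PM y.
have M0 : 0 <= M by apply: le_trans (PM 0).
apply: (@le_trans _ _ (\int[mu]_t (M%:E * (k s (t - y))%:E))%E).
  apply: ge0_le_integral => //.
  - by apply/measurable_EFinP; apply: measurableT_comp => //; apply: measurable_funM => //; exact: measurable_translate.
  - by apply: measurable_funeM; apply/measurable_EFinP; exact: measurable_translate.
  - move=> t _; rewrite -EFinM lee_fin normrM (ger0_norm (k_ge0 _ _)).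
    by rewrite ler_wpM2r.
rewrite ge0_integralZl//; last 2 first.
- by apply/measurable_EFinP; exact: measurable_translate.
- by move=> t _; rewrite lee_fin.
rewrite (integral_translate y ((measurable_EFinP _ _).2 (mk s))).
rewrite EFinM /Rintegral fineK//.
exact: integrable_fin_num (ik s0).
Qed.

(** On []a, b[] this is the left fractional integral of order 1 - alpha of u, and [V] below is the
    primitive of v from [a]. Outside it their values are immaterial, but as convolutions they are
    integrable on the line. *)
Let w x := G1^-1 * convolution u0 (k (1 - alpha)) x.
Let V x := convolution v0 (k 1) x.

Let one_bounded (s : R) : 0 < s -> forall y,
  (\int[mu]_t `|1 * k s (t - y)|%:E <= (1 * \int[mu]_t k s t)%:E)%E.
Proof. by move=> s0; apply: (@bounded_kernel s (fun=> 1)) => // x; rewrite normr1. Qed.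

Let iconv (s : R) (f : R -> R) : 0 < s -> mu.-integrable setT (EFin \o f) ->
  mu.-integrable setT (EFin \o convolution f (k s)).
Proof.
move=> s0 intf.
have := integrable_convolution intf (mk s) (measurable_cst _) (one_bounded s0).
by apply: eq_integrable => // x _; rewrite /= mul1r.
Qed.

Let iw : mu.-integrable setT (EFin \o w).
Proof.
have := integrableZl measurableT G1^-1 (iconv a1' iu0).
by apply: eq_integrable.
Qed.

Let iV : mu.-integrable setT (EFin \o V).
Proof. exact: iconv ltr01 iv0. Qed.

Lemma Rintegral_mkcond_zero (f : R -> R) : (forall x, ~~ (a < x < b) -> f x = 0) ->
  \int[mu]_(x in `]a, b[) f x = \int[mu]_x f x.
Proof.
move=> f0; rewrite Rintegral_mkcond; apply: eq_Rintegral => x _.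
rewrite patchE mem_setE in_itv/=.
by case: (boolP (a < x < b)) => // /f0 ->.
Qed.

(** After Fubini the integral of phi' against the kernel is [right_fderiv alpha phi] up to the
    factor - Gamma(1 - alpha), so the weak derivative of u appears. *)
Let weak_w phi : test_function `]a, b[ phi ->
  \int[mu]_x (derive1 phi x * w x) = - \int[mu]_(x in `]a, b[) (v x * phi x).
Proof.
move=> tphi; rewrite uv//.
have [N N0 phiN] := test_derive1_bounded tphi.
have mphi := measurable_test_derive1 tphi.
have B := bounded_kernel a1' mphi phiN.
transitivity (G1^-1 * \int[mu]_x (derive1 phi x * convolution u0 (k (1 - alpha)) x)).
  rewrite -RintegralZl//; last exact: integrable_convolution B.
  by apply: eq_Rintegral => x _; rewrite /w mulrCA.
rewrite (convolution_fubini iu0 (mk _) mphi B).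
have idual := integrable_convolution_dual iu0 (mk _) mphi B.
have -> : \int[mu]_(x in `]a, b[) (u x * right_fderiv alpha phi x) =
    \int[mu]_y (- G1^-1 * (u0 y * \int[mu]_t (derive1 phi t * k (1 - alpha) (t - y)))).
  rewrite Rintegral_mkcond; apply: eq_Rintegral => y _.
  rewrite /u0 !patchE mem_setE in_itv/=; case: ifPn => yab; last by rewrite mul0r mulr0.
  by rewrite (right_fderiv_test_kernel tphi)// mulrCA.
by rewrite !(RintegralZl _ measurableT idual) mulNr opprK.
Qed.

Let weak_V phi : test_function `]a, b[ phi ->
  \int[mu]_x (derive1 phi x * V x) = - \int[mu]_(x in `]a, b[) (v x * phi x).
Proof.
move=> tphi.
have [N N0 phiN] := test_derive1_bounded tphi.
have mphi := measurable_test_derive1 tphi.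
have B := bounded_kernel ltr01 mphi phiN.
rewrite (convolution_fubini iv0 (mk _) mphi B).
have -> : \int[mu]_(x in `]a, b[) (v x * phi x) = \int[mu]_x (v0 x * phi x).
  rewrite -Rintegral_mkcond_zero; last by move=> x xab; rewrite (test_eq0 tphi)// mulr0.
  by apply: eq_Rintegral => x xab; rewrite /v0 patchE xab.
have iphi : mu.-integrable setT (EFin \o (fun x => v0 x * phi x)).
  have [M M0 phiM] := test_bounded tphi.
  have := integrable_bounded_kernel (measurable_test tphi) iv0 phiM.
  by apply: eq_integrable => // x _; rewrite /= mulrC.
rewrite -mulN1r -(RintegralZl _ measurableT iphi).
apply: eq_Rintegral => y _; rewrite mulN1r /v0 patchE mem_setE in_itv/=.
case: ifPn => yab; last by rewrite !mul0r oppr0.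
by rewrite test_integral_derive1// mulrN.
Qed.

Let wV : exists K, {ae mu, forall x, a < x < b -> w x = K + V x}.
Proof.
pose g x := w x - V x.
have ig : mu.-integrable setT (EFin \o g).
  by have := integrableB measurableT iw iV; apply: eq_integrable.
have igab : mu.-integrable `]a, b[ (EFin \o g) by exact: integrableS ig.
have [phi tphi|K gK] := dubois_reymond_mean ab igab.
  rewrite Rintegral_mkcond_zero; last first.
    by move=> x xab; rewrite (test_derive1_eq0 tphi)// mulr0.
  have [N N0 phiN] := test_derive1_bounded tphi.
  have mphi := measurable_test_derive1 tphi.
  have i1 := integrable_bounded_kernel mphi iw phiN.
  have i2 := integrable_bounded_kernel mphi iV phiN.
  rewrite -[RHS](subrr (- \int[mu]_(x in `]a, b[) (v x * phi x))).
  rewrite -{1}(weak_w tphi) -(weak_V tphi).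
  rewrite -(@RintegralB _ _ _ mu _ _ _ measurableT i1 i2).
  by apply: eq_Rintegral => x _; rewrite /g -mulrBr mulrC.
exists K.
have iK c d : mu.-integrable `]c, d[ (EFin \o (fun=> K)).
  apply: measurable_bounded_integrable => //; last exact: bounded_cst.
  have := @lebesgue_measure_itv R `]c, d[.
  by rewrite /= => ->; case: ifP => // _; rewrite -EFinB ltry.
have igK : mu.-integrable `]a, b[ (EFin \o (fun x => g x - K)).
  by have := integrableB (mitv _) igab (iK a b); apply: eq_integrable.
have := ae_eq0_itv igK.
have h c d : a < c -> c < d -> d < b -> \int[mu]_(x in `]c, d[) (g x - K) = 0.
  move=> ac cd db.
  have igcd : mu.-integrable `]c, d[ (EFin \o g) by exact: integrableS ig.
  rewrite (@RintegralB _ _ _ mu `]c, d[%classic _ _ (mitv _) igcd (iK c d)).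
  rewrite gK// Rintegral_cst//.
  have := @lebesgue_measure_itv R `]c, d[.
  by rewrite /= lte_fin cd => ->; rewrite -EFinB subrr.
move=> /(_ h); apply: filterS; first exact: (ae_filter_ringOfSetsType mu).
move=> x /[apply].
by rewrite /g => /eqP; rewrite subr_eq0 subr_eq => /eqP ->.
Qed.

Let VE x : a < x < b -> V x = \int[mu]_(y in `[a, x]) v0 y.
Proof.
move=> /andP[ax xb].
have iv0S (i : interval R) : mu.-integrable [set` i] (EFin \o v0).
  by apply: integrableS iv0 => //; exact: mitv.
rewrite -Rintegral_itv_bndo_bndc// -Rintegral_itv_obnd_cbnd//.
rewrite [RHS]Rintegral_mkcond; apply: eq_Rintegral => y _.
rewrite /k power_kernel_1 patchE mem_setE in_itv/= subr_gt0.
have [yx|xy] := ltP y x; last by rewrite /= andbF mulr0.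
rewrite andbT /=; case: ifPn => ay; first by rewrite (_ : x - y < b - a) ?mulr1//; lra.
by rewrite /v0 patchE mem_setE in_itv/= (negbTE ay)/= mul0r.
Qed.

Let left_constE K : {ae mu, forall x, a < x < b -> w x = K + V x} ->
  left_const a b alpha u = K / Ga.
Proof.
move=> wK; rewrite /left_const; congr (_ / _).
pose g x := K + parameterized_integral mu a x v0.
rewrite (@cont_rep_valueE _ a b _ g ab).
- by rewrite /g /parameterized_integral set_itv1 Rintegral_set1 addr0.
- have iv0ab : mu.-integrable `[a, b] (EFin \o v0) by apply: integrableS iv0.
  have cv := parameterized_integral_continuous (ltW ab) iv0ab.
  move=> x; apply: cvgD; first exact: cvg_cst.
  exact: cv.
- move: wK; apply: filterS; first exact: (ae_filter_ringOfSetsType mu).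
  move=> x h xab.
  rewrite (left_fintE _ _ xab) -/u0 -/(k (1 - alpha)) -/G1 -/(w x) h//.
  by rewrite /g VE.
Qed.

(** Gamma(alpha) times u - c kappa - I^alpha v, with c = K / Gamma(alpha). *)
Let residual K (t : R) : R :=
  Ga * u0 t - K * k alpha (t - a) - convolution v0 (k alpha) t.

Let integrable_residual K : mu.-integrable setT (EFin \o residual K).
Proof.
have i1 := integrableZl measurableT Ga iu0.
have ika := integrable_translate a (ik a0).
have i2 := integrableZl measurableT K ika.
have i3 := iconv a0 iv0.
have := integrableB measurableT (integrableB measurableT i1 i2) i3.
by apply: eq_integrable.
Qed.

Section at_point.
Variable x : R.
Hypothesis xab : a < x < b.

(** Integrating against [P] gives Gamma(alpha) times the fractional integral of order alpha at [x],
    and integrating against [Q], the indicator of []a, x[], gives the primitive at [x]. The number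
    [J] is (x - a)^alpha / alpha; it stays unevaluated because it cancels. *)
Let P t := power_kernel alpha (x - a) (x - t).
Let Q t := power_kernel 1 (x - a) (x - t).
Let J := \int[mu]_t power_kernel alpha (x - a) t.

Let mP : measurable_fun [set: R] P.
Proof. by apply: measurable_reflect; exact: measurable_power_kernel. Qed.

Let mQ : measurable_fun [set: R] Q.
Proof. by apply: measurable_reflect; exact: measurable_power_kernel. Qed.

Let P_ge0 t : 0 <= P t. Proof. exact: power_kernel_ge0. Qed.

Let Q_le1 t : `|Q t| <= 1.
Proof. by rewrite /Q power_kernel_1; case: (0 < _ < _); rewrite ?normr1 ?normr0. Qed.

Let PJ : \int[mu]_t P t = J.
Proof. exact: (Rintegral_reflect _ (measurable_power_kernel _ _)). Qed.

Let intP : (\int[mu]_t (P t)%:E = J%:E)%E.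
Proof.
rewrite (integral_reflect x ((measurable_EFinP _ _).2 (measurable_power_kernel _ _))).
rewrite /J /Rintegral fineK//; exact: integrable_fin_num (power_kernel_integrable _ a0).
Qed.

Let iP : mu.-integrable setT (EFin \o P).
Proof.
apply/integrableP; split; first exact/measurable_EFinP.
under eq_integral do rewrite /= ger0_norm//.
by rewrite intP ltry.
Qed.

(** [P] is unbounded here, so [bounded_kernel] does not apply; the beta integral supplies the bound
    uniform in [y]. *)
Let beta_bound y :
  (\int[mu]_t `|P t * k (1 - alpha) (t - y)|%:E <= (Ga * G1)%:E)%E.
Proof.
apply: le_trans (integral_beta_le x y alpha01).
apply: ge0_le_integral => //.
- apply/measurable_EFinP; apply: measurableT_comp => //; apply: measurable_funM => //.
  exact: measurable_translate.
- apply/measurable_EFinP; apply: measurable_funM.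
    by apply: measurable_reflect; exact: measurable_half_power.
  by apply: measurable_translate; exact: measurable_half_power.
- move=> t _; rewrite lee_fin ger0_norm; last by rewrite mulr_ge0.
  by rewrite ler_pM// power_kernel_le_half.
Qed.

Let one_bound y : (\int[mu]_t `|P t * k 1 (t - y)|%:E <= J%:E)%E.
Proof.
rewrite -intP; apply: ge0_le_integral => //.
- apply/measurable_EFinP; apply: measurableT_comp => //; apply: measurable_funM => //.
  exact: measurable_translate.
- exact/measurable_EFinP.
- move=> t _; rewrite lee_fin ger0_norm; last by rewrite mulr_ge0.
  rewrite ler_piMr// /k power_kernel_1.
  by case: (0 < _ < _).
Qed.

Let Qbound y : (\int[mu]_t `|Q t * k alpha (t - y)|%:E <= (1 * \int[mu]_t k alpha t)%:E)%E.
Proof. exact: bounded_kernel. Qed.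

Let xitv y : a < y < b -> (0 < x - y < x - a) = (y < x).
Proof.
move=> /andP[ay yb]; rewrite subr_gt0; case: (y < x) => //=; lra.
Qed.

Let int_u : mu.-integrable setT (EFin \o (fun y => Q y * u0 y)).
Proof. exact: integrable_bounded_kernel. Qed.

(** The semigroup law for the orders alpha and 1 - alpha: the inner integral over t is [Ga * G1] for
    y < x and 0 for y >= x, which is the factor [Q y]. *)
Let Pw_u : \int[mu]_t (P t * w t) = Ga * \int[mu]_y (Q y * u0 y).
Proof.
transitivity (G1^-1 * \int[mu]_t (P t * convolution u0 (k (1 - alpha)) t)).
  rewrite -(RintegralZl _ measurableT (integrable_convolution iu0 (mk _) mP beta_bound)).
  by apply: eq_Rintegral => t _; rewrite /w mulrCA.
rewrite (convolution_fubini iu0 (mk _) mP beta_bound).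
transitivity (G1^-1 * \int[mu]_y ((Ga * G1) * (Q y * u0 y))).
  congr (_ * _); apply: eq_Rintegral => y _.
  rewrite /u0 patchE mem_setE in_itv/=; case: ifPn => yab; last by rewrite mul0r !mulr0.
  have yab' : a <= y < b by case/andP: yab => /ltW -> ->.
  rewrite mulrA mulrC; congr (_ * _).
  rewrite /Q power_kernel_1 xitv//.
  rewrite (_ : \int[mu]_t _ = fine (\int[mu]_t (half_power alpha (x - t) * half_power (1 - alpha) (t - y))%:E)%E); last first.
    by apply: (congr1 fine); apply: eq_integral => t _; rewrite power_kernel_cut_beta.
  have [yx|xy] := ltP y x; first by rewrite beta_kernel// mulr1.
  rewrite mulr0 integral0_eq// => t _; have [yt|ty] := ltP y t; last first.
    by rewrite [X in _ * X]half_power0 ?mulr0// subr_le0.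
  by rewrite half_power0 ?mul0r// subr_le0 (le_trans xy)// ltW.
rewrite (RintegralZl _ measurableT int_u) mulrA; congr (_ * _).
by rewrite mulrCA mulVf ?mulr1// gt_eqF.
Qed.

Let Pw_K K : {ae mu, forall x, a < x < b -> w x = K + V x} ->
  \int[mu]_t (P t * w t) = K * J + \int[mu]_t (P t * V t).
Proof.
move=> wK.
have iPw : mu.-integrable setT (EFin \o (fun t => P t * w t)).
  have := integrableZl measurableT G1^-1 (integrable_convolution iu0 (mk _) mP beta_bound).
  by apply: eq_integrable => // t _; rewrite /= -EFinM mulrCA.
have iPV := integrable_convolution iv0 (mk _) mP one_bound.
have iKP : mu.-integrable setT (EFin \o (fun t => K * P t)).
  by have := integrableZl measurableT K iP; apply: eq_integrable.
transitivity (\int[mu]_t (K * P t + P t * V t)).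
  apply: (congr1 fine); apply: ae_eq_integral => //.
  - exact: measurable_int iPw.
  - by have := integrableD measurableT iKP iPV => /(measurable_int mu).
  - move: wK; apply: filterS; first exact: (ae_filter_ringOfSetsType mu).
    move=> t h _.
    have [tab|tab] := boolP (a < t < b); first by rewrite h// mulrDr mulrC.
    rewrite /P power_kernel0 ?mul0r ?mulr0 ?addr0//.
    apply: contra tab => /andP[h1 h2]; case/andP: xab => ax xb.
    by apply/andP; split; lra.
rewrite (RintegralD measurableT iKP iPV); congr (_ + _).
by rewrite (RintegralZl _ measurableT iP) PJ.
Qed.

(** Integrals of orders alpha and 1 commute: after Fubini both sides integrate v0 y times the
    integral of [power_kernel alpha (x - y)], reflected at [x] on the left and translated by [y] on
    the right. *)
Let QV : \int[mu]_t (P t * V t) = \int[mu]_t (Q t * convolution v0 (k alpha) t).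
Proof.
apply: (etrans (convolution_fubini iv0 (mk _) mP one_bound)).
apply/esym; apply: (etrans (convolution_fubini iv0 (mk _) mQ Qbound)).
apply/esym; apply: eq_Rintegral => y _.
rewrite /v0 patchE mem_setE in_itv/=; case: ifPn => yab; last by rewrite !mul0r.
have yab' : a <= y < b by case/andP: yab => /ltW -> ->.
congr (_ * _).
under eq_Rintegral do rewrite (power_kernel_cutl _ _ yab' xab).
under [RHS]eq_Rintegral do rewrite (power_kernel_cutr _ _ yab' xab).
rewrite (Rintegral_reflect x (measurable_power_kernel _ _)).
by rewrite (Rintegral_translate y (measurable_power_kernel _ _)).
Qed.

Let Qkernel : \int[mu]_t (Q t * k alpha (t - a)) = J.
Proof.
have aab : a <= a < b by rewrite lexx.
under eq_Rintegral do rewrite (power_kernel_cutr _ _ aab xab).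
exact: (Rintegral_translate a (measurable_power_kernel _ _)).
Qed.

(* The two evaluations [Pw_u] and [Pw_K] of the convolution of w with the kernel of
   order alpha are the primitives of Ga u0 and of the two other terms. *)
Lemma residual_primitive K : {ae mu, forall x, a < x < b -> w x = K + V x} ->
  \int[mu]_(t in `]a, x[) residual K t = 0.
Proof.
move=> wK.
have e t : (residual K \_ `]a, x[) t = Q t * residual K t.
  rewrite patchE mem_setE in_itv/= /Q power_kernel_1 subr_gt0.
  rewrite (_ : (x - t < x - a) = (a < t)) 1?andbC; last by apply/idP/idP; lra.
  by case: (_ && _); rewrite ?mul1r ?mul0r.
rewrite Rintegral_mkcond; under eq_Rintegral do rewrite e.
have ika : mu.-integrable setT (EFin \o (fun t => Q t * k alpha (t - a))).
  exact: integrable_bounded_kernel mQ (integrable_translate a (ik a0)) Q_le1.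
have i1 : mu.-integrable setT (EFin \o (fun t => Ga * (Q t * u0 t))).
  by have := integrableZl measurableT Ga int_u; apply: eq_integrable.
have i2 : mu.-integrable setT (EFin \o (fun t => K * (Q t * k alpha (t - a)))).
  by have := integrableZl measurableT K ika; apply: eq_integrable.
have i3 : mu.-integrable setT (EFin \o (fun t => Q t * convolution v0 (k alpha) t)).
  exact: integrable_convolution Qbound.
have i12 : mu.-integrable setT (EFin \o (fun t => Ga * (Q t * u0 t) - K * (Q t * k alpha (t - a)))).
  by have := integrableB measurableT i1 i2; apply: eq_integrable.
transitivity (\int[mu]_t (Ga * (Q t * u0 t) - K * (Q t * k alpha (t - a)) -
   Q t * convolution v0 (k alpha) t)).
  by apply: eq_Rintegral => t _; rewrite /residual; ring.
rewrite (RintegralB measurableT i12 i3) (RintegralB measurableT i1 i2).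
rewrite (RintegralZl _ measurableT int_u) (RintegralZl _ measurableT ika).
rewrite Qkernel -QV -Pw_u (Pw_K wK); ring.
Qed.

End at_point.

Theorem left_representation : {ae mu, forall x, a < x < b ->
  u x - left_const a b alpha u * left_kernel a alpha x =
  Ga^-1 * convolution v0 (k alpha) x}.
Proof.
have [K wK] := wV.
have ires := integrable_residual K.
have iresS (i : interval R) : mu.-integrable [set` i] (EFin \o residual K).
  by apply: integrableS ires => //; exact: mitv.
have h c d : a < c -> c < d -> d < b -> \int[mu]_(x in `]c, d[) residual K x = 0.
  move=> ac cd db.
  have -> : \int[mu]_(x in `]c, d[) residual K x =
      \int[mu]_(x in `]a, d[) residual K x - \int[mu]_(x in `]a, c]) residual K x.
    by rewrite Rintegral_itvB// bnd_simp ltW.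
  rewrite -Rintegral_itv_bndo_bndc// !(residual_primitive _ wK) ?subrr//.
    by rewrite (lt_trans ac cd).
  by rewrite ac (lt_trans cd).
have := ae_eq0_itv (iresS _) h.
apply: filterS; first exact: (ae_filter_ringOfSetsType mu).
move=> x r0 xab; have := r0 xab.
rewrite /residual (left_constE wK) /u0 patchE mem_setE in_itv/= xab.
have -> : k alpha (x - a) = left_kernel a alpha x.
  by rewrite /k power_kernelE//; lra.
move=> /eqP; rewrite subr_eq0 => /eqP <-.
by field; rewrite gt_eqF.
Qed.

End left_representation.

(** * The norm inequality on the left side *)

Section left_inequality.
Context {R : realType}.
Local Notation mu := (@lebesgue_measure R).
Implicit Types (a b p alpha : R) (u v f : R -> R).

Lemma Lnorm_scale_le (f g : R -> R) (c p : R) : 1 <= p -> 0 <= c ->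
  measurable_fun [set: R] f -> measurable_fun [set: R] g ->
  {ae mu, forall x, `|f x| <= c * `|g x|} ->
  ('N[mu]_p%:E[EFin \o f] <= c%:E * 'N[mu]_p%:E[EFin \o g])%E.
Proof.
move=> p1 c0 mf mg fg.
have p0 : 0 < p by apply: lt_le_trans p1.
have mpow (h : R -> R) : measurable_fun [set: R] h ->
    measurable_fun [set: R] (fun x => (`|h x| `^ p)%:E).
  move=> mh; apply/measurable_EFinP; apply: (measurableT_comp (measurable_powR _)).
  exact: measurableT_comp.
rewrite unlock /Lnorm.
have e h : (\int[mu]_x (`|(EFin \o h) x| `^ p) = \int[mu]_x (`|h x| `^ p)%:E)%E.
  by apply: eq_integral.
rewrite !e.
have ge0 h : (0 <= \int[mu]_x (`|h x| `^ p)%:E)%E.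
  by apply: integral_ge0 => x _; rewrite lee_fin powR_ge0.
have {1}-> : c = (c `^ p) `^ p^-1 by rewrite -powRrM mulfV ?gt_eqF// powRr1.
rewrite -poweR_EFin -poweRM ?lee_fin ?powR_ge0//.
apply: gt0_ler_poweR; rewrite ?in_itv/= ?leey ?andbT//.
- by rewrite invr_ge0 ltW.
- by rewrite mule_ge0// lee_fin powR_ge0.
- rewrite -ge0_integralZl//; last 2 first.
  + exact: mpow.
  + by rewrite lee_fin powR_ge0.
  apply: ae_ge0_le_integral => //.
  + exact: mpow.
  + by move=> x _; rewrite mule_ge0// lee_fin powR_ge0.
  + by apply: measurable_funeM; exact: mpow.
  + move: fg; apply: filterS; first exact: (ae_filter_ringOfSetsType mu).
    move=> x h _; rewrite -EFinM lee_fin -powRM//.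
    by apply: ge0_ler_powR; rewrite ?nnegrE ?mulr_ge0// ltW.
Qed.

(** |f| <= 1 + |f|^p, and the interval has finite measure. *)
Lemma Lnorm_lty_integrable a b p f : 1 <= p -> measurable_fun `]a, b[ f ->
  (Lp_norm `]a, b[ p f < +oo)%E -> mu.-integrable `]a, b[ (EFin \o f).
Proof.
move=> p1 mf.
have p0 : 0 < p by apply: lt_le_trans p1.
have mf0 : measurable_fun [set: R] (f \_ `]a, b[).
  by apply/(measurable_restrictT _ _).1 => //; exact: measurable_itv.
rewrite /Lp_norm => /(poweR_lty p); rewrite poweR_Lnorm ?gt_eqF// => flty.
have mfp : measurable_fun `]a, b[ (fun x => (`|f x| `^ p)%:E).
  apply/measurable_EFinP; apply: (measurableT_comp (measurable_powR _)).
  exact: measurableT_comp.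
have i1 : mu.-integrable `]a, b[ (EFin \o (fun=> 1)).
  apply: measurable_bounded_integrable => //; last exact: bounded_cst.
  have := @lebesgue_measure_itv R `]a, b[.
  by rewrite /= => ->; case: ifP => // _; rewrite -EFinB ltry.
have i2 : mu.-integrable `]a, b[ (fun x => (`|f x| `^ p)%:E).
  apply/integrableP; split => //.
  apply: le_lt_trans flty; rewrite [leLHS]integral_mkcond.
  rewrite le_eqVlt; apply/orP; left; apply/eqP; apply: eq_integral => x _.
  rewrite !patchE /= patchE; case: ifP => _.
    by rewrite /= [in LHS]ger0_norm// powR_ge0.
  by rewrite normr0 powR0// gt_eqF.
apply: (le_integrable _ _ _ (integrableD _ i1 i2)) => //.
- exact/measurable_EFinP.
- move=> x _; rewrite /= lee_fin [leRHS]ger0_norm ?addr_ge0 ?powR_ge0//.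
  have [f1|f1] := leP `|f x| 1; first by rewrite (le_trans f1)// lerDl powR_ge0.
  by apply: (@le_trans _ _ (`|f x| `^ p)); rewrite ?le1r_powR ?(ltW f1)// lerDr.
Qed.

(** For a < b and alpha > 0 this is (b - a)^alpha / Gamma(alpha + 1), the L^1 norm of the truncated
    kernel of I^alpha. It depends on the interval through [b - a] alone, hence is invariant under
    reflection. *)
Definition fint_constant a b alpha : R :=
  (\int[mu]_x power_kernel alpha (b - a) x) / Gamma alpha.

Lemma fint_constant_ge0 a b alpha : 0 < alpha < 1 -> 0 <= fint_constant a b alpha.
Proof.
move=> a0; rewrite divr_ge0 ?(ltW (Gamma_gt0 _))//.
by apply: Rintegral_ge0 => x _; exact: power_kernel_ge0.
Qed.

Lemma left_inequality a b alpha p u v : a < b -> 0 < alpha < 1 -> 1 <= p ->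
  mu.-integrable `]a, b[ (EFin \o u) -> measurable_fun `]a, b[ v ->
  (forall phi, test_function `]a, b[ phi ->
     \int[mu]_(x in `]a, b[) (v x * phi x) =
     \int[mu]_(x in `]a, b[) (u x * right_fderiv alpha phi x)) ->
  (Lp_norm `]a, b[ p (fun x => u x - left_const a b alpha u * left_kernel a alpha x)%R
     <= (fint_constant a b alpha + 1)%:E * Lp_norm `]a, b[ p v)%E.
Proof.
move=> ab alpha01 p1 iu mv uv.
have a0 : 0 < alpha by case/andP: alpha01.
have G0 : 0 < Gamma alpha by exact: Gamma_gt0.
have c0 := fint_constant_ge0 a b alpha01.
have [vfin|] := ltP (Lp_norm `]a, b[ p v) +oo%E; last first.
  (* With an infinite norm on the right the factor must be positive, as 0 times +oo is 0; the added
     1 ensures this. *)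
  by rewrite leye_eq => /eqP ->; rewrite gt0_muley ?leey// lte_fin ltr_wpDl.
have iv := Lnorm_lty_integrable p1 mv vfin.
have rep := left_representation ab alpha01 iu iv uv.
have mv0 : measurable_fun [set: R] (v \_ `]a, b[).
  by apply/(measurable_restrictT _ _).1 => //; exact: measurable_itv.
have mu0 : measurable_fun `]a, b[ u by apply/measurable_EFinP; exact: measurable_int iu.
have ik := power_kernel_integrable (b - a) a0.
have young := young_convolution p1 mv0 ik (power_kernel_ge0 _ _).
set h := convolution _ _ in young.
have mh : measurable_fun [set: R] h.
  by apply: measurable_convolution => //; exact: measurable_power_kernel.
rewrite /Lp_norm.
apply: (@le_trans _ _ ((Gamma alpha)^-1%:E * 'N[mu]_p%:E[EFin \o h])%E).
  apply: Lnorm_scale_le => //.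
  - by rewrite invr_ge0 ltW.
  - apply/(measurable_restrictT _ _).1; first exact: measurable_itv.
    apply: measurable_funB => //; apply: measurable_funM => //.
    apply: measurable_funTS; apply: (measurableT_comp (measurable_powR _)).
    exact: measurable_funB.
  - move: rep; apply: filterS; first exact: (ae_filter_ringOfSetsType mu).
    move=> x hx; rewrite patchE mem_setE in_itv/=; case: ifPn => xab.
      by rewrite hx// normrM gtr0_norm ?invr_gt0.
    by rewrite normr0 mulr_ge0// invr_ge0 ltW.
apply: (@le_trans _ _ ((fint_constant a b alpha)%:E * 'N[mu]_p%:E[EFin \o (v \_ `]a, b[)])%E); last first.
  by apply: lee_wpmul2r; rewrite ?Lnorm_ge0// lee_fin lerDl.
rewrite /fint_constant mulrC EFinM -muleA.
by apply: lee_wpmul2l => //; rewrite lee_fin invr_ge0 ltW.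
Qed.

End left_inequality.

(** * Reflection and the inequality on the right side *)

Section reflection.
Context {R : realType}.
Local Notation mu := (@lebesgue_measure R).
Implicit Types (a b c p x alpha : R) (u v f phi : R -> R).

Definition reflect_fun f : R -> R := fun x => f (- x).

Let mN : measurable_fun [set: R] (-%R : R -> R).
Proof. exact: measurable_funN. Qed.

Lemma reflect_funK f : reflect_fun (reflect_fun f) = f.
Proof. by apply/funext => x; rewrite /reflect_fun opprK. Qed.

Lemma integral_reflect0 (g : R -> \bar R) : measurable_fun [set: R] g ->
  (\int[mu]_x g (- x)%R = \int[mu]_x g x)%E.
Proof.
move=> mg; rewrite -(integral_reflect 0 mg).
by apply: eq_integral => x _; rewrite sub0r.
Qed.

Lemma measurable_reflect_itv (g : R -> \bar R) a b :
  measurable_fun `]a, b[ g -> measurable_fun `](- b), (- a)[ (fun x => g (- x)).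
Proof.
move=> mg; apply: (measurable_comp _ _ mg) => //.
- move=> _ [x + <-]; rewrite /= !in_itv/= => /andP[bx xa].
  by apply/andP; split; lra.
Qed.

Lemma integral_reflect_itv (g : R -> \bar R) a b : measurable_fun `]a, b[ g ->
  (\int[mu]_(x in `](- b)%R, (- a)%R[) g (- x)%R = \int[mu]_(x in `]a, b[) g x)%E.
Proof.
move=> mg; rewrite integral_mkcond [RHS]integral_mkcond.
have mg0 : measurable_fun [set: R] (g \_ `]a, b[).
  by apply/(measurable_restrictT _ _).1 => //; exact: measurable_itv.
rewrite -(integral_reflect0 mg0); apply: eq_integral => x _.
rewrite !patchE !mem_setE !in_itv/= (_ : (- b < x < - a) = (a < - x < b))//.
by apply/idP/idP => /andP[? ?]; apply/andP; split; lra.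
Qed.

Lemma integrable_reflect_itv f a b : mu.-integrable `]a, b[ (EFin \o f) ->
  mu.-integrable `](- b), (- a)[ (EFin \o reflect_fun f).
Proof.
move=> /integrableP[mf foo]; apply/integrableP; split.
  exact: measurable_reflect_itv mf.
have mnf : measurable_fun `]a, b[ (fun x => `|(EFin \o f) x|%E).
  exact: measurableT_comp.
by rewrite -(integral_reflect_itv mnf) in foo.
Qed.

Lemma ae_reflect (P : R -> Prop) : {ae mu, forall x, P x} -> {ae mu, forall x, P (- x)}.
Proof.
move=> [N [mN' N0 subN]].
have mNN : measurable ((-%R : R -> R) @^-1` N).
  by rewrite -[X in measurable X]setTI; exact: mN.
exists ((-%R : R -> R) @^-1` N); split => //.
- by rewrite -[RHS]N0; exact: (lebesgue_measureN mN').
- by move=> x /= nP; exact: subN.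
Qed.

Lemma Lp_norm_reflect a b p f : measurable_fun `]a, b[ f ->
  Lp_norm `](- b), (- a)[ p (reflect_fun f) = Lp_norm `]a, b[ p f.
Proof.
move=> mf; rewrite /Lp_norm unlock /Lnorm; apply: (congr1 (fun z => poweR z p^-1)).
have mf0 : measurable_fun [set: R] (f \_ `]a, b[).
  by apply/(measurable_restrictT _ _).1 => //; exact: measurable_itv.
have mg : measurable_fun [set: R] (fun x => (`|(EFin \o f \_ `]a, b[) x| `^ p)%E).
  apply/measurable_EFinP; apply: (measurableT_comp (measurable_powR _)).
  exact: measurableT_comp.
rewrite -(integral_reflect0 mg); apply: eq_integral => x _; congr (`|_| `^ _)%E.
rewrite /= !patchE !mem_setE !in_itv/= (_ : (- b < x < - a) = (a < - x < b))//.
by apply/idP/idP => /andP[? ?]; apply/andP; split; lra.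
Qed.

Lemma is_derive_reflect f x df : is_derive (- x) (1 : R) f df ->
  is_derive x (1 : R) (reflect_fun f) (- df).
Proof.
move=> h; have := @is_derive_affine _ f 0 (-1) x df.
rewrite add0r mulN1r mulN1r => /(_ h); congr is_derive.
by apply/funext => y; rewrite add0r mulN1r.
Qed.

Lemma smooth_reflect f : smooth f -> smooth (reflect_fun f).
Proof.
move=> sf; have := @smooth_affine _ f 0 (-1) sf.
by congr smooth; apply/funext => y; rewrite add0r mulN1r.
Qed.

Lemma test_function_reflect a b phi : test_function `]a, b[ phi ->
  test_function `](- b), (- a)[ (reflect_fun phi).
Proof.
move=> tphi; have [_ cphi subphi] := tphi.
pose S := (-%R : R -> R) @` closure [set x | phi x != 0].
have cS : compact S.
  by apply: continuous_compact => //; apply: continuous_subspaceT; exact: opp_continuous.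
have sub : closure [set x | reflect_fun phi x != 0] `<=` S.
  have /closure_id -> : closed S by apply: compact_closed => //; exact: Rhausdorff.
  apply: closureS => x /= px; exists (- x); last by rewrite opprK.
  exact: subset_closure.
split.
- by apply: smooth_reflect; exact: (test_smooth tphi).
- by apply: (subclosed_compact _ cS sub); exact: closed_closure.
- move=> _ /sub[x /subphi + <-]; rewrite /= !in_itv/= => /andP[ax xb].
  by rewrite !ltrN2 xb.
Qed.

(** The sign from differentiating t |-> F (- t) is the one in the definition of [right_fderiv]. The
    chain rule needs the derivative of [F] to exist, which [is_derive_test_tail] provides. *)
Lemma left_fderiv_reflect a b alpha phi x : alpha < 1 -> test_function `]a, b[ phi ->
  left_fderiv alpha phi x = right_fderiv alpha (reflect_fun phi) (- x).
Proof.
move=> a1 tphi.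
have tphi' := test_function_reflect tphi.
set F := fun t : R => \int[mu]_(y in `]t, +oo[) (reflect_fun phi y / (y - t) `^ alpha).
have FE t : \int[mu]_(y in `]-oo, t[) (phi y / (t - y) `^ alpha) = F (- t).
  rewrite /F Rintegral_mkcond [RHS]Rintegral_mkcond.
  have mG : measurable_fun [set: R] ((fun y => phi y / (t - y) `^ alpha) \_ `]-oo, t[).
    apply/(measurable_restrictT _ _).1; first exact: measurable_itv.
    apply: measurable_funTS; apply: measurable_funM; first exact: (measurable_test tphi).
    have -> : (fun y => ((t - y) `^ alpha)^-1) = (fun y => (t - y) `^ (- alpha)).
      by apply/funext => y; rewrite powRN.
    apply: (measurableT_comp (measurable_powR _)).
    exact: measurable_funB.
  rewrite -(Rintegral_reflect 0 mG); apply: eq_Rintegral => y _.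
  rewrite !patchE !mem_setE !in_itv/= sub0r andbT ltrNl /reflect_fun.
  by case: ifP => // _; congr (_ / _ `^ _); rewrite !opprK; exact: addrC.
have dF : is_derive (- x) 1 F _ := is_derive_test_tail tphi' a1 (- x).
have dE (f : R -> R) (y df : R) : is_derive y 1 f df -> derive1 f y = df.
  by move=> [_ <-]; rewrite derive1E.
have e1 := dE _ _ _ (is_derive_reflect dF).
rewrite -(dE _ _ _ dF) in e1.
apply: (etrans (y := (Gamma (1 - alpha))^-1 * derive1 (reflect_fun F) x)).
  rewrite /left_fderiv.
  by apply: (congr1 (fun h : R -> R => (Gamma (1 - alpha))^-1 * derive1 h x)); exact/funext.
by rewrite e1 mulrN -mulNr.
Qed.

(** On []a, b[] it is a multiple of the convolution of phi' with the reflected kernel. Measurability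
    is what the change of variables in [weak_fderiv_reflect] asks for. *)
Lemma measurable_right_fderiv a b alpha phi : alpha < 1 -> test_function `]a, b[ phi ->
  measurable_fun `]a, b[ (right_fderiv alpha phi).
Proof.
move=> a1 tphi; pose k := power_kernel (1 - alpha) (b - a).
have mk : measurable_fun [set: R] (reflect_fun k).
  by apply: measurableT_comp => //; exact: measurable_power_kernel.
apply: (@eq_measurable_fun _ _ _ _ _
  (fun x => - (Gamma (1 - alpha))^-1 * convolution (derive1 phi) (reflect_fun k) x)).
  move=> x; rewrite inE/= in_itv/= => xab.
  rewrite (right_fderiv_test_kernel tphi a1 xab); apply: (congr1 (fun z => _ * z)).
  by apply: eq_Rintegral => y _; rewrite /reflect_fun opprB.
apply: measurable_funM => //; apply: measurable_funTS.
apply: measurable_convolution => //; exact: (measurable_test_derive1 tphi).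
Qed.

Lemma Rintegral_reflect_itv f a b : measurable_fun `]a, b[ f ->
  \int[mu]_(x in `](- b), (- a)[) f (- x) = \int[mu]_(x in `]a, b[) f x.
Proof.
by move=> mf; rewrite /Rintegral -(integral_reflect_itv ((measurable_EFinP _ _).2 mf)).
Qed.

Lemma weak_fderiv_reflect a b alpha u v phi : alpha < 1 ->
  is_right_weak_fderiv a b alpha u v -> test_function `](- b), (- a)[ phi ->
  \int[mu]_(x in `](- b), (- a)[) (reflect_fun v x * phi x) =
  \int[mu]_(x in `](- b), (- a)[) (reflect_fun u x * right_fderiv alpha phi x).
Proof.
move=> a1 [iu [mv _ _] uv] tphi.
have mu0 : measurable_fun `]a, b[ u by apply/measurable_EFinP; exact: measurable_int iu.
have tphi' : test_function `]a, b[ (reflect_fun phi).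
  by rewrite -(opprK a) -(opprK b); exact: test_function_reflect.
have lE x : left_fderiv alpha (reflect_fun phi) x = right_fderiv alpha phi (- x).
  by rewrite (left_fderiv_reflect x a1 tphi') reflect_funK.
have h : \int[mu]_(x in `]a, b[) (v x * reflect_fun phi x) =
    \int[mu]_(x in `]a, b[) (u x * right_fderiv alpha phi (- x)).
  by rewrite (uv _ tphi'); apply: eq_Rintegral => x _; rewrite lE.
have m1 : measurable_fun `]a, b[ (fun x => v x * reflect_fun phi x).
  by apply: measurable_funM => //; apply: measurable_funTS; exact: (measurable_test tphi').
have m2 : measurable_fun `]a, b[ (fun x => u x * right_fderiv alpha phi (- x)).
  apply: measurable_funM => //.
  have := measurable_reflect_itv ((measurable_EFinP _ _).2 (measurable_right_fderiv a1 tphi)).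
  by rewrite !opprK => /measurable_EFinP.
rewrite -(Rintegral_reflect_itv m1) -(Rintegral_reflect_itv m2) in h.
transitivity (\int[mu]_(x in `](- b), (- a)[) (v (- x) * reflect_fun phi (- x))).
  by apply: eq_Rintegral => x _; rewrite /reflect_fun opprK.
by rewrite h; apply: eq_Rintegral => x _; rewrite opprK.
Qed.

Lemma right_fint_reflect a b s u x : measurable_fun `]a, b[ u -> a < x < b ->
  right_fint b s u x = left_fint (- b) s (reflect_fun u) (- x).
Proof.
move=> mu0 /andP[ax xb]; rewrite /right_fint /left_fint.
apply: (congr1 (fun z => _ * z)).
rewrite -Rintegral_reflect_itv; last first.
  apply: measurable_funM.
    apply: measurable_funS mu0; first exact: measurable_itv.
    by apply: subset_itvr; rewrite bnd_simp ltW.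
  apply: measurable_funTS.
  have -> : (fun y => ((y - x) `^ (1 - s))^-1) = (fun y => (y - x) `^ (- (1 - s))).
    by apply/funext => y; rewrite powRN.
  apply: (measurableT_comp (measurable_powR _)).
  exact: measurable_funB.
apply: eq_Rintegral => y _; rewrite /reflect_fun.
by rewrite (addrC (- y)).
Qed.

Lemma within_continuous_reflect a b f : {within `[a, b], continuous f} ->
  {within `[(- b), (- a)], continuous (reflect_fun f)}.
Proof.
move=> /subspace_continuousP cf; apply/subspace_continuousP => x.
rewrite /= in_itv/= => /andP[bx xa].
have xab : `[a, b]%classic (- x) by rewrite /= in_itv/=; apply/andP; split; lra.
apply: cvg_comp (cf _ xab) => A /= [e e0 eA].
exists e => // y /= xy; rewrite in_itv/= => /andP[yb ya].
apply: eA => /=; last by rewrite in_itv/=; apply/andP; split; lra.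
by rewrite /ball_ opprK addrC -normrN opprD opprK addrC in xy *.
Qed.

(** [xget] depends only on the set of candidate values, and reflection identifies the two sets; this
    covers the default value too. Reflection being an involution, the inclusion [sub] gives both
    directions. *)
Lemma cont_rep_value_reflect a b f g t : (forall x, a < x < b -> f x = g (- x)) ->
  cont_rep_value a b f t = cont_rep_value (- b) (- a) g (- t).
Proof.
have sub (c d s : R) f1 g1 : (forall x, c < x < d -> f1 x = g1 (- x)) ->
    [set l | exists h : R -> R, [/\ {within `[c, d], continuous h},
       f1 = h %[ae mu in `]c, d[%classic] & h s = l]] `<=`
    [set l | exists h : R -> R, [/\ {within `[(- d), (- c)], continuous h},
       g1 = h %[ae mu in `](- d), (- c)[%classic] & h (- s) = l]].
  move=> fg l [h [ch fh hl]]; exists (reflect_fun h); split.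
  - exact: within_continuous_reflect.
  - have := ae_reflect fh; apply: filterS; first exact: (ae_filter_ringOfSetsType mu).
    move=> x hx /=; rewrite in_itv/= => /andP[dx xc].
    have xcd : c < - x < d by apply/andP; split; lra.
    by rewrite -(opprK x) -fg// opprK hx//= in_itv.
  - by rewrite /reflect_fun opprK.
move=> fg; rewrite /cont_rep_value; congr xget; apply/seteqP; split.
  exact: sub.
have := sub (- b) (- a) (- t) g f; rewrite !opprK; apply => x /andP[bx xa].
by rewrite -(opprK x) -fg ?opprK//; apply/andP; split; lra.
Qed.

Lemma right_const_reflect a b alpha u : measurable_fun `]a, b[ u ->
  right_const a b alpha u = left_const (- b) (- a) alpha (reflect_fun u).
Proof.
move=> mu0; congr (_ / _); apply: cont_rep_value_reflect => x xab.
exact: (right_fint_reflect _ mu0 xab).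
Qed.

Lemma right_inequality a b alpha p u v : a < b -> 0 < alpha < 1 -> 1 <= p ->
  is_right_weak_fderiv a b alpha u v ->
  (Lp_norm `]a, b[ p (fun x => u x - right_const a b alpha u * right_kernel b alpha x)%R
     <= (fint_constant a b alpha + 1)%:E * Lp_norm `]a, b[ p v)%E.
Proof.
move=> ab alpha01 p1 uv.
have [iu [mv _ _] _] := uv.
have a1 : alpha < 1 by case/andP: alpha01.
have mu0 : measurable_fun `]a, b[ u by apply/measurable_EFinP; exact: measurable_int iu.
have ba : - b < - a by rewrite ltrN2.
have mv' : measurable_fun `](- b), (- a)[ (reflect_fun v).
  by have /measurable_EFinP := measurable_reflect_itv ((measurable_EFinP _ _).2 mv).
have := left_inequality ba alpha01 p1 (integrable_reflect_itv iu) mv'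
  (fun phi => weak_fderiv_reflect a1 uv).
rewrite -(right_const_reflect _ mu0) (Lp_norm_reflect p mv).
have -> : fint_constant (- b) (- a) alpha = fint_constant a b alpha.
  by rewrite /fint_constant (_ : - a - - b = b - a)//; ring.
apply: le_trans; rewrite le_eqVlt; apply/orP; left; apply/eqP.
rewrite -Lp_norm_reflect; last first.
  apply: measurable_funB => //; apply: measurable_funM => //.
  apply: measurable_funTS; apply: (measurableT_comp (measurable_powR _)).
  exact: measurable_funB.
congr (Lp_norm _ _ _); apply/funext => x; rewrite /reflect_fun /right_kernel /left_kernel.
by congr (_ - _ * _ `^ _); ring.
Qed.

End reflection.

Theorem theorem4p25 (R : realType) (a b alpha : R)
  (hab : a < b) (halpha : 0 < alpha < 1) :
  exists2 C : R, 0 < C & forall p : R, 1 <= p ->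
    (forall u v : R -> R,
       left_fSobolev a b alpha p u -> is_left_weak_fderiv a b alpha u v ->
       (Lp_norm `]a, b[ p
          (fun x => u x - left_const a b alpha u * left_kernel a alpha x)%R
        <= C%:E * Lp_norm `]a, b[ p v)%E) /\
    (forall u v : R -> R,
       right_fSobolev a b alpha p u -> is_right_weak_fderiv a b alpha u v ->
       (Lp_norm `]a, b[ p
          (fun x => u x - right_const a b alpha u * right_kernel b alpha x)%R
        <= C%:E * Lp_norm `]a, b[ p v)%E).
Proof.
exists (fint_constant a b alpha + 1).
  by rewrite ltr_wpDl// fint_constant_ge0.
move=> p p1; split=> u v _.
  by move=> [iu [mv _ _] uv]; exact: left_inequality.
exact: right_inequality.
Qed.
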